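(* Let $n\ge0$ be an integer and $x>0$. Then, for either choice of the sign $\pm$, $$\left.\frac{\partial \mathrm{W}_{\kappa,\mu}(x)}{\partial\kappa}\right|_{\kappa=0,\ \mu=\pm(n+1/2)}=\sqrt{\frac{x}{\pi}}\,K_{n+1/2}\left(\frac x2\right)\left[H_n+\mathrm{E}_1(x)+\ln x\right]+e^{-x/2}\sum_{k=0}^{n}\frac{(n+k)!\,x^{-k}}{k!\,(n-k)!}\left[(-1)^{n+k+1}\,\Gamma(-n-k,x)\,\gamma(n+k+1,-x)-H_{n+k}-\sum_{\ell=1}^{n+k}\binom{n+k}{\ell}(-x)^{-\ell}\gamma(\ell,x)\right].$$
   Context: For $x>0$, the Whittaker function is $\mathrm{W}_{\kappa,\mu}(x)=e^{-x/2}x^{\mu+1/2}\,\mathrm{U}\left(\frac12+\mu-\kappa,1+2\mu,x\right)$, where $\mathrm{U}$ is the Tricomi confluent hypergeometric function. $K_\nu$ is the modified Bessel function of the second kind. $\gamma(\nu,z)=\int_0^z t^{\nu-1}e^{-t}\,dt$ ($\mathrm{Re}\,\nu>0$) and $\Gamma(\nu,z)=\int_z^\infty t^{\nu-1}e^{-t}\,dt$ are the lower and upper incomplete gamma functions. $\mathrm{E}_1(x)=\int_x^\infty\frac{e^{-t}}{t}\,dt$ is the exponential integral. $H_k=\sum_{j=1}^k\frac1j$ is the $k$-th harmonic number ($H_0=0$). *)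

(* Defs.v *)
From Stdlib Require Import Reals ZArith.
From Coquelicot Require Import Coquelicot.
Open Scope R_scope.

(* [Rpower x y] is only ever used with x > 0, where it is x^y; integer powers
   of possibly negative numbers are written with [powerRZ]. *)

(* Kummer's equation z w'' + (b - z) w' - a w = 0 on (0, +oo). *)
Definition kummer_solution (a b : R) (w : R -> R) : Prop :=
  forall z : R, 0 < z ->
    ex_derive w z /\ ex_derive (Derive w) z /\
    z * Derive (Derive w) z + (b - z) * Derive w z - a * w z = 0.

(* DLMF 13.2.6: U(a,b,.) is the solution of Kummer's equation with
   w(z) ~ z^(-a) at infinity, for all parameters a and b (b a nonpositive
   integer included).  On the positive half-line the behaviour at +oo
   suffices to single it out, since any independent solution grows like
   e^z z^(a-b). *)
Definition is_tricomi (a b : R) (w : R -> R) : Prop :=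
  kummer_solution a b w /\
  is_lim (fun z => Rpower z a * w z) p_infty 1.

(* Solutions are determined on (0, +oo) only, hence the description is of the
   value at x > 0 rather than of a function R -> R. *)
Definition tricomiU (a b x : R) : R :=
  iota (fun y : R => exists w : R -> R, is_tricomi a b w /\ w x = y).

Definition whittakerW (kappa mu x : R) : R :=
  exp (- x / 2) * Rpower x (mu + 1 / 2)
  * tricomiU (1 / 2 + mu - kappa) (1 + 2 * mu) x.

Definition modified_bessel_solution (nu : R) (w : R -> R) : Prop :=
  forall z : R, 0 < z ->
    ex_derive w z /\ ex_derive (Derive w) z /\
    z ^ 2 * Derive (Derive w) z + z * Derive w z - (z ^ 2 + nu ^ 2) * w z = 0.

(* DLMF 10.25.3: K_nu is the solution of the modified Bessel equation with
   w(z) ~ sqrt (pi / (2 z)) e^(-z) at infinity; any independent solution grows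
   like e^z / sqrt z on the positive half-line. *)
Definition is_besselK (nu : R) (w : R -> R) : Prop :=
  modified_bessel_solution nu w /\
  is_lim (fun z => w z / (sqrt (PI / (2 * z)) * exp (- z))) p_infty 1.

Definition besselK (nu x : R) : R :=
  iota (fun y : R => exists w : R -> R, is_besselK nu w /\ w x = y).

(* Incomplete gamma functions of integer order: the integrands are then real
   for arguments of either sign.  [gamma_lower] is meaningful for m >= 1 and
   every real z ([RInt] is oriented, so z may be negative), [gamma_upper] for
   every m and z > 0. *)
Definition gamma_lower (m : Z) (z : R) : R :=
  RInt (fun t => powerRZ t (m - 1) * exp (- t)) 0 z.

Definition gamma_upper (m : Z) (z : R) : R :=
  RInt_gen (fun t => powerRZ t (m - 1) * exp (- t))
    (at_point z) (Rbar_locally p_infty).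

Definition expint_E1 (x : R) : R :=
  RInt_gen (fun t => exp (- t) / t) (at_point x) (Rbar_locally p_infty).

Definition harmonic (k : nat) : R := sum_n_m (fun j => 1 / INR j) 1 k.

(* Main.v *)
(* With F(x, a, b) the integral of e^(-x t) t^a (1 + t)^b over (0, +oo), both signs of mu give
     W_(kappa, mu)(x) = e^(-x/2) x^(n+1) F(x, n - kappa, n + kappa) / F(1, n - kappa, 0)
   for kappa near 0: the right-hand side solves the differential equation with the prescribed
   behaviour at infinity, and a positive recessive solution is unique.  Expanding
   (1 + t)^n and differentiating in kappa leaves the integrals of e^(-x t) t^m against ln t and
   against ln (1 + t), with m = n + k.  The identities F satisfies hold for all exponents, so
   differentiating them in an exponent gives the recurrences of these two integrals: the first
   one produces H_m - ln x plus a constant which cancels against the derivative of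
   F(1, n - kappa, 0), the second one the incomplete gamma functions, because
   Gamma(-m, x) = e^(-x) F(x, m, -1) / m!. *)

Require Import Defs.
From Stdlib Require Import Reals ZArith Lra Lia.
From Coquelicot Require Import Coquelicot.
Open Scope R_scope.

(** * An absolutely convergent integral over the positive half-line *)

(** [tricomiU] and [besselK] are descriptions by [iota], so they have a known value only once
    existence and uniqueness are both proved; one comparison with an explicit positive solution
    serves both functions. For mu = -(n + 1/2) the first parameter of U is -n - kappa, and no
    neighbourhood of kappa = 0 lies in the range of the integral representation; Kummer's
    transformation moves this case to positive mu before any integral appears. Differentiation under
    the integral is carried out along a straight line in (x, a, b): one explicit second-order
    estimate yields the derivatives in x, in a, in b, and in the direction (0, -1, 1) in which kappa
    moves. The constant that cancels is the integral of e^(-t) ln t, that is, minus Euler's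
    constant; its value never enters. *)

Definition trunc_int (h : R -> R) (N : nat) : R :=
  RInt h (/ (INR N + 1)) (INR N + 1).

(** Both improper ends are approached along one sequence, so linearity and order pass from [RInt] to
    the limit. [Lim_seq] and [real] are total; the value is meaningful once [dominated_cv]
    applies. *)
Definition half_int (h : R -> R) : R := real (Lim_seq (trunc_int h)).

(** Written as a single exponential of a form linear in the parameters: shifting them multiplies by
    an exponential, and comparing two kernels is a linear inequality between t, ln t and ln (1 +
    t). *)
Definition ker (x a b t : R) : R := exp (- (x * t) + a * ln t + b * ln (1 + t)).

(* Majorant of the class of integrands: 1 / (sqrt t (1 + t)), with primitive 2 atan (sqrt t). *)
Definition half_majorant (t : R) : R := ker 0 (- 1 / 2) (- 1) t.

Definition dominated (h : R -> R) : Prop :=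
  (forall t, 0 < t -> continuous h t) /\
  exists C, forall t, 0 < t -> Rabs (h t) <= C * half_majorant t.

Lemma trunc_bounds (N : nat) : 0 < / (INR N + 1) /\ / (INR N + 1) <= 1 /\ 1 <= INR N + 1.
Proof.
  pose proof (pos_INR N).
  split; [apply Rinv_0_lt_compat; lra|]. split; [|lra].
  rewrite <- Rinv_1. apply Rinv_le_contravar; lra.
Qed.

Lemma ker_pos (x a b t : R) : 0 < ker x a b t.
Proof. apply exp_pos. Qed.

Lemma ker_continuous (x a b t : R) : 0 < t -> continuous (ker x a b) t.
Proof.
  intros Ht. apply (ex_derive_continuous (K := R_AbsRing) (V := R_NormedModule)).
  unfold ker. auto_derive. lra.
Qed.

Lemma ex_RInt_half (h : R -> R) (a b : R) :
  (forall t, 0 < t -> continuous h t) -> 0 < a -> a <= b -> ex_RInt h a b.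
Proof.
  intros Hc Ha Hab. apply (ex_RInt_continuous (V := R_CompleteNormedModule)).
  intros z Hz. rewrite Rmin_left in Hz by lra. apply Hc. lra.
Qed.

Lemma ex_trunc_int (h : R -> R) (N : nat) :
  (forall t, 0 < t -> continuous h t) ->
  ex_RInt h (/ (INR N + 1)) (INR N + 1).
Proof.
  intros Hc. pose proof (trunc_bounds N). apply ex_RInt_half; auto; lra.
Qed.

Lemma trunc_int_plus (h k : R -> R) (N : nat) :
  (forall t, 0 < t -> continuous h t) -> (forall t, 0 < t -> continuous k t) ->
  trunc_int (fun t => h t + k t) N = trunc_int h N + trunc_int k N.
Proof.
  intros Hh Hk. unfold trunc_int.
  apply (RInt_plus (V := R_CompleteNormedModule)); apply ex_trunc_int; auto.
Qed.

Lemma trunc_int_scal (c : R) (h : R -> R) (N : nat) :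
  (forall t, 0 < t -> continuous h t) ->
  trunc_int (fun t => c * h t) N = c * trunc_int h N.
Proof.
  intros Hh. unfold trunc_int.
  apply (RInt_scal (V := R_CompleteNormedModule)); apply ex_trunc_int; auto.
Qed.

Lemma trunc_int_le (h k : R -> R) (N : nat) :
  (forall t, 0 < t -> continuous h t) -> (forall t, 0 < t -> continuous k t) ->
  (forall t, 0 < t -> h t <= k t) -> trunc_int h N <= trunc_int k N.
Proof.
  intros Hh Hk Hle. pose proof (trunc_bounds N).
  apply RInt_le; try apply ex_trunc_int; auto; try lra.
  intros t Ht. apply Hle. lra.
Qed.

Lemma trunc_int_ext (h k : R -> R) (N : nat) :
  (forall t, 0 < t -> h t = k t) -> trunc_int h N = trunc_int k N.
Proof.
  intros He. pose proof (trunc_bounds N). apply RInt_ext.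
  intros t Ht. rewrite Rmin_left in Ht by lra. apply He. lra.
Qed.

Lemma trunc_int_incr (h : R -> R) (N : nat) :
  (forall t, 0 < t -> continuous h t) -> (forall t, 0 < t -> 0 <= h t) ->
  trunc_int h N <= trunc_int h (S N).
Proof.
  intros Hc Hp. pose proof (trunc_bounds N) as (H1 & H2 & H3).
  pose proof (trunc_bounds (S N)) as (H4 & H5 & H6).
  assert (H7 : / (INR (S N) + 1) <= / (INR N + 1)).
  { apply Rinv_le_contravar; rewrite ?S_INR; lra. }
  assert (H8 : INR N + 1 <= INR (S N) + 1) by (rewrite S_INR; lra).
  unfold trunc_int.
  assert (E1 := RInt_Chasles h (/ (INR (S N) + 1)) (/ (INR N + 1)) (INR (S N) + 1)).
  assert (E2 := RInt_Chasles h (/ (INR N + 1)) (INR N + 1) (INR (S N) + 1)).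
  change plus with Rplus in E1, E2.
  rewrite <- E1, <- E2 by (apply ex_RInt_half; auto; lra).
  assert (0 <= RInt h (/ (INR (S N) + 1)) (/ (INR N + 1))).
  { apply RInt_ge_0; auto. apply ex_RInt_half; auto. intros; apply Hp; lra. }
  assert (0 <= RInt h (INR N + 1) (INR (S N) + 1)).
  { apply RInt_ge_0; auto. apply ex_RInt_half; auto; lra. intros; apply Hp; lra. }
  lra.
Qed.

Lemma trunc_int_majorant_le (N : nat) : trunc_int half_majorant N <= 2 * PI.
Proof.
  pose proof (trunc_bounds N) as (H1 & H2 & H3).
  assert (Hd : forall t, 0 < t ->
    is_derive (fun t => 2 * atan (exp (ln t / 2))) t (half_majorant t)).
  { intros t Ht. auto_derive; [lra|].
    unfold half_majorant, ker.
    assert (E : exp (ln t * / 2) * (exp (ln t * / 2) * 1) = t).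
    { rewrite Rmult_1_r, <- exp_plus. replace (_ + _) with (ln t) by field.
      now apply exp_ln. }
    rewrite E.
    replace (- (0 * t) + -1 / 2 * ln t + - 1 * ln (1 + t))
      with (ln t * / 2 + - ln t + - ln (1 + t)) by field.
    rewrite !exp_plus, !exp_Ropp, !exp_ln by lra. field. lra. }
  unfold trunc_int.
  rewrite (is_RInt_unique _ _ _ _
    (is_RInt_derive (fun t => 2 * atan (exp (ln t / 2))) half_majorant (/ (INR N + 1)) (INR N + 1)
    ltac:(intros t Ht; rewrite Rmin_left in Ht by lra; apply Hd; lra)
    ltac:(intros t Ht; rewrite Rmin_left in Ht by lra; apply ker_continuous; lra))).
  unfold minus, plus, opp; simpl.
  pose proof (atan_bound (exp (ln (INR N + 1) / 2))).
  pose proof (atan_bound (exp (ln (/ (INR N + 1)) / 2))).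
  lra.
Qed.

Lemma trunc_int_cv_pos (h : R -> R) (C : R) :
  (forall t, 0 < t -> continuous h t) ->
  (forall t, 0 < t -> 0 <= h t <= C * half_majorant t) ->
  ex_finite_lim_seq (trunc_int h).
Proof.
  intros Hc Hb. apply ex_finite_lim_seq_incr with (M := C * (2 * PI)).
  - intros N. apply trunc_int_incr; auto. intros t Ht; apply Hb, Ht.
  - intros N.
    assert (HC : 0 <= C).
    { destruct (Hb 1 Rlt_0_1). pose proof (ker_pos 0 (-1/2) (-1) 1).
      unfold half_majorant in *. apply Rnot_lt_le. intro. nra. }
    apply Rle_trans with (trunc_int (fun t => C * half_majorant t) N).
    + apply trunc_int_le; auto.
      * intros t Ht. apply (continuous_scal_r C half_majorant). now apply ker_continuous.
      * intros t Ht; apply Hb, Ht.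
    + rewrite trunc_int_scal by (intros; now apply ker_continuous).
      apply Rmult_le_compat_l; auto. apply trunc_int_majorant_le.
Qed.

(** Monotone convergence needs a sign: h + C m and C m, with m the majorant, are nonnegative and
    bounded by multiples of m, so both truncated integrals converge, and h is their difference. *)
Lemma dominated_cv (h : R -> R) :
  dominated h -> is_lim_seq (trunc_int h) (half_int h).
Proof.
  intros (Hc & C & Hb).
  assert (Hm : forall t, 0 < t -> continuous (fun t => C * half_majorant t) t).
  { intros t Ht. apply (continuous_scal_r C half_majorant). now apply ker_continuous. }
  assert (Hhm : forall t, 0 < t -> continuous (fun t => h t + C * half_majorant t) t).
  { intros t Ht. apply (continuous_plus (V := R_NormedModule) h); auto. }
  destruct (trunc_int_cv_pos (fun t => h t + C * half_majorant t) (2 * C)) as (l1 & Hl1); auto.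
  { intros t Ht. specialize (Hb t Ht). apply Rabs_le_between in Hb. lra. }
  destruct (trunc_int_cv_pos (fun t => C * half_majorant t) C) as (l2 & Hl2); auto.
  { intros t Ht. specialize (Hb t Ht). pose proof (Rabs_pos (h t)). lra. }
  assert (H : is_lim_seq (trunc_int h) (l1 - l2)).
  { eapply is_lim_seq_ext; [|apply (is_lim_seq_minus' _ _ _ _ Hl1 Hl2)].
    intros N. simpl. rewrite trunc_int_plus by auto. ring. }
  unfold half_int. rewrite (is_lim_seq_unique _ _ H). exact H.
Qed.

Lemma half_int_unique (h : R -> R) (l : R) :
  is_lim_seq (trunc_int h) l -> half_int h = l.
Proof. intros H. unfold half_int. now rewrite (is_lim_seq_unique _ _ H). Qed.

Lemma half_int_ext (h k : R -> R) :
  (forall t, 0 < t -> h t = k t) -> half_int h = half_int k.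
Proof.
  intros He. unfold half_int. f_equal. apply Lim_seq_ext.
  intros N. now apply trunc_int_ext.
Qed.

Lemma dominated_ext (h k : R -> R) :
  (forall t, 0 < t -> h t = k t) -> dominated h -> dominated k.
Proof.
  intros He (Hc & C & Hb). split.
  - intros t Ht. apply (continuous_ext_loc _ h); auto.
    exists (mkposreal t Ht). intros y Hy. apply He.
    apply Rabs_def2 in Hy. simpl in Hy. unfold minus, plus, opp in Hy; simpl in Hy. lra.
  - exists C. intros t Ht. rewrite <- He; auto.
Qed.

Lemma dominated_le (h k : R -> R) :
  (forall t, 0 < t -> continuous h t) ->
  (exists C, forall t, 0 < t -> Rabs (h t) <= C * k t) -> dominated k -> dominated h.
Proof.
  intros Hc (C & HC) (_ & D & HD). split; auto. exists (Rabs C * D).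
  intros t Ht. specialize (HC t Ht); specialize (HD t Ht).
  pose proof (Rabs_pos (k t)). pose proof (Rle_abs (C * k t)).
  rewrite Rabs_mult in *. pose proof (Rabs_pos C). nra.
Qed.

Lemma dominated_plus (h k : R -> R) :
  dominated h -> dominated k -> dominated (fun t => h t + k t).
Proof.
  intros (Hc & C & Hb) (Kc & D & Kb). split.
  - intros t Ht. apply (continuous_plus (V := R_NormedModule) h); auto.
  - exists (C + D). intros t Ht. specialize (Hb t Ht); specialize (Kb t Ht).
    pose proof (Rabs_triang (h t) (k t)). lra.
Qed.

Lemma dominated_scal (c : R) (h : R -> R) : dominated h -> dominated (fun t => c * h t).
Proof.
  intros (Hc & C & Hb). split.
  - intros t Ht. apply (continuous_scal_r c h); auto.
  - exists (Rabs c * C). intros t Ht. specialize (Hb t Ht).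
    rewrite Rabs_mult. pose proof (Rabs_pos c). nra.
Qed.

Lemma half_int_plus (h k : R -> R) :
  dominated h -> dominated k ->
  half_int (fun t => h t + k t) = half_int h + half_int k.
Proof.
  intros Hh Hk. apply half_int_unique.
  eapply is_lim_seq_ext;
    [|apply (is_lim_seq_plus' _ _ _ _ (dominated_cv _ Hh) (dominated_cv _ Hk))].
  intros N. simpl. rewrite trunc_int_plus; auto; [apply Hh|apply Hk].
Qed.

Lemma half_int_scal (c : R) (h : R -> R) :
  dominated h -> half_int (fun t => c * h t) = c * half_int h.
Proof.
  intros Hh. apply half_int_unique.
  eapply is_lim_seq_ext; [|apply (is_lim_seq_scal_l _ c _ (dominated_cv _ Hh))].
  intros N. simpl. rewrite trunc_int_scal; auto. apply Hh.
Qed.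

Lemma half_int_le (h k : R -> R) :
  dominated h -> dominated k -> (forall t, 0 < t -> h t <= k t) ->
  half_int h <= half_int k.
Proof.
  intros Hh Hk Hle.
  apply (is_lim_seq_le (trunc_int h) (trunc_int k) (half_int h) (half_int k));
    try now apply dominated_cv.
  intros N. apply trunc_int_le; auto; [apply Hh|apply Hk].
Qed.

Lemma half_int_abs_le (h k : R -> R) :
  dominated h -> dominated k -> (forall t, 0 < t -> Rabs (h t) <= k t) ->
  Rabs (half_int h) <= half_int k.
Proof.
  intros Hh Hk Hle. apply Rabs_le. split.
  - replace (- half_int k) with (half_int (fun t => (-1) * k t))
      by (rewrite half_int_scal; auto; ring).
    apply half_int_le; auto. now apply dominated_scal.
    intros t Ht. specialize (Hle t Ht). apply Rabs_le_between in Hle. lra.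
  - apply half_int_le; auto.
    intros t Ht. specialize (Hle t Ht). apply Rabs_le_between in Hle. lra.
Qed.

(** The truncated integrals increase to the limit, and the one over [1/2, 2] is already positive. *)
Lemma half_int_pos (h : R -> R) :
  dominated h -> (forall t, 0 < t -> 0 < h t) -> 0 < half_int h.
Proof.
  intros Hh Hp.
  apply Rlt_le_trans with (trunc_int h 1).
  - unfold trunc_int. simpl. apply RInt_gt_0; try lra.
    + intros t Ht. apply Hp. lra.
    + intros t Ht. apply Hh. lra.
  - apply (is_lim_seq_incr_compare (trunc_int h)).
    + now apply dominated_cv.
    + intros N. apply trunc_int_incr; [apply Hh|]. intros; now apply Rlt_le, Hp.
Qed.

Lemma half_int_derive (H h : R -> R) (l0 l1 : R) :
  dominated h -> (forall t, 0 < t -> is_derive H t (h t)) ->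
  is_lim_seq (fun N => H (/ (INR N + 1))) l0 ->
  is_lim_seq (fun N => H (INR N + 1)) l1 ->
  half_int h = l1 - l0.
Proof.
  intros Hd HH H0 H1. apply half_int_unique.
  eapply is_lim_seq_ext; [|apply (is_lim_seq_minus' _ _ _ _ H1 H0)].
  intros N. simpl. symmetry. apply is_RInt_unique.
  pose proof (trunc_bounds N).
  apply (is_RInt_derive H h); intros t Ht; rewrite Rmin_left in Ht by lra.
  - apply HH. lra.
  - apply Hd. lra.
Qed.

(** * The two-parameter Laplace transform *)

Definition laplace (x a b : R) : R := half_int (ker x a b).

Lemma exp_le (y z : R) : y <= z -> exp y <= exp z.
Proof.
  intros [H| ->]; [now apply Rlt_le, exp_increasing|lra].
Qed.

Lemma ln_1p_le (t : R) : 0 < t -> 0 <= ln (1 + t) <= t.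
Proof.
  intros Ht. split.
  - rewrite <- ln_1. apply ln_le; lra.
  - rewrite <- (ln_exp t) at 2. apply ln_le; [lra|]. apply exp_ineq1_le.
Qed.

Lemma ln_le_ln_1p (t : R) : 0 < t -> ln t <= ln (1 + t).
Proof. intros Ht. apply ln_le; lra. Qed.

(** A bound linear in ln t and ln (1 + t), valid without splitting at t = 1, so that its exponential
    is again a kernel. *)
Lemma Rabs_ln_le (t : R) : 0 < t -> Rabs (ln t) <= - ln t + 2 * ln (1 + t).
Proof.
  intros Ht. pose proof (ln_1p_le t Ht). pose proof (ln_le_ln_1p t Ht).
  apply Rabs_le. lra.
Qed.

Lemma ln_1p_sublinear (c e : R) :
  0 < e -> exists K, forall t, 0 < t -> c * ln (1 + t) <= e * t + K.
Proof.
  intros He. pose proof (Rabs_pos c).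
  (* The bound ln y <= y is used at y = d (1 + t); this d makes the resulting slope |c| d at most
     e. *)
  set (d := e / (Rabs c + 1)).
  assert (Hd : 0 < d) by (apply Rdiv_lt_0_compat; lra).
  assert (Hcd : Rabs c * d <= e).
  { assert (d * (Rabs c + 1) = e) by (unfold d; field; lra). nra. }
  exists (e + Rabs c * - ln d). intros t Ht.
  assert (Hl : ln (1 + t) <= d * (1 + t) - ln d).
  { assert (H1 : ln (d * (1 + t)) <= d * (1 + t)).
    { rewrite <- (ln_exp (d * (1 + t))) at 2.
      apply ln_le; [apply Rmult_lt_0_compat; lra|].
      pose proof (exp_ineq1_le (d * (1 + t))). lra. }
    rewrite ln_mult in H1 by lra. lra. }
  pose proof (ln_1p_le t Ht). pose proof (Rle_abs c).
  apply Rle_trans with (Rabs c * ln (1 + t)); [nra|].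
  apply Rle_trans with (Rabs c * (d * (1 + t) - ln d)); nra.
Qed.

(** Divided by the majorant, the kernel has t-exponent a + 1/2 >= 0, so t may be replaced there by 1
    + t; the remaining power of 1 + t is absorbed by e^(-x t) up to the constant e^K. *)
Lemma dominated_ker (x a b : R) : 0 < x -> - 1 / 2 <= a -> dominated (ker x a b).
Proof.
  intros Hx Ha. split; [intros; now apply ker_continuous|].
  destruct (ln_1p_sublinear (a + 1 / 2 + (b + 1)) x Hx) as (K & HK).
  exists (exp K). intros t Ht. rewrite Rabs_pos_eq by apply Rlt_le, ker_pos.
  unfold half_majorant, ker. rewrite <- exp_plus.
  apply exp_le. specialize (HK t Ht). pose proof (ln_le_ln_1p t Ht). nra.
Qed.

Lemma laplace_pos (x a b : R) : 0 < x -> - 1 / 2 <= a -> 0 < laplace x a b.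
Proof.
  intros. apply half_int_pos; [now apply dominated_ker|]. intros; apply ker_pos.
Qed.

Lemma laplace_le (x y a b c : R) :
  0 < x <= y -> - 1 / 2 <= a -> b <= c -> laplace y a b <= laplace x a c.
Proof.
  intros Hx Ha Hb. apply half_int_le; try apply dominated_ker; try lra.
  intros t Ht. apply exp_le. pose proof (ln_1p_le t Ht). nra.
Qed.

(** The logarithmic derivative of the kernel when (x, a, b) moves in the direction (u, p, q). *)
Definition dir (u p q t : R) : R := - (u * t) + p * ln t + q * ln (1 + t).

Lemma ker_dir (x a b u p q s t : R) :
  ker (x + s * u) (a + s * p) (b + s * q) t = exp (s * dir u p q t) * ker x a b t.
Proof. unfold ker, dir. rewrite <- exp_plus. f_equal. ring. Qed.

Lemma dir_continuous (u p q t : R) : 0 < t -> continuous (dir u p q) t.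
Proof.
  intros Ht. apply (ex_derive_continuous (K := R_AbsRing) (V := R_NormedModule)).
  unfold dir. auto_derive. lra.
Qed.

(** The modulus of [dir] is bounded by a linear form in t, ln t and ln (1 + t), so a small multiple
    of it in the exponent only shifts the parameters of the kernel. The factor 2 leaves one
    exponential for the Taylor remainder and one for the square of [dir]. *)
Lemma exp_dir_ker_le (x a b u p q : R) :
  0 < x -> - 1 / 2 < a ->
  exists s0, 0 < s0 /\ exists x' a' b', 0 < x' /\ - 1 / 2 <= a' /\
  forall t, 0 < t -> exp (2 * s0 * Rabs (dir u p q t)) * ker x a b t <= ker x' a' b' t.
Proof.
  intros Hx Ha. pose proof (Rabs_pos u). pose proof (Rabs_pos p). pose proof (Rabs_pos q).
  (* With these radii x and a + 1/2 each keep at least half of their value after the shift. *)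
  set (s1 := x / (4 * (Rabs u + 1))). set (s2 := (a + 1 / 2) / (4 * (Rabs p + 1))).
  assert (E1 : s1 * (Rabs u + 1) = x / 4) by (unfold s1; field; lra).
  assert (E2 : s2 * (Rabs p + 1) = (a + 1 / 2) / 4) by (unfold s2; field; lra).
  assert (P1 : 0 < s1) by (apply Rdiv_lt_0_compat; lra).
  assert (P2 : 0 < s2) by (apply Rdiv_lt_0_compat; lra).
  exists (Rmin s1 s2). set (s0 := Rmin s1 s2).
  assert (P0 : 0 < s0) by now apply Rmin_glb_lt.
  assert (L1 : s0 <= s1) by apply Rmin_l. assert (L2 : s0 <= s2) by apply Rmin_r.
  split; auto.
  exists (x - 2 * s0 * Rabs u), (a - 2 * s0 * Rabs p),
    (b + 4 * s0 * Rabs p + 2 * s0 * Rabs q).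
  split; [nra|]. split; [nra|].
  intros t Ht. unfold ker. rewrite <- exp_plus. apply exp_le.
  assert (HB : Rabs (dir u p q t) <=
    Rabs u * t + Rabs p * (- ln t + 2 * ln (1 + t)) + Rabs q * ln (1 + t)).
  { unfold dir. pose proof (Rabs_ln_le t Ht). pose proof (ln_1p_le t Ht).
    eapply Rle_trans; [apply Rabs_triang|]. apply Rplus_le_compat.
    - eapply Rle_trans; [apply Rabs_triang|]. apply Rplus_le_compat.
      + rewrite Rabs_Ropp, Rabs_mult, (Rabs_pos_eq t); lra.
      + rewrite Rabs_mult. now apply Rmult_le_compat_l.
    - rewrite Rabs_mult, (Rabs_pos_eq (ln (1 + t))); lra. }
  apply (Rmult_le_compat_l (2 * s0)) in HB; lra.
Qed.

(** From e^(-y) >= 1 - y follows e^y - 1 <= y e^y, hence 0 <= e^y - 1 - y <= y (e^y - 1), which is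
    at most y^2 e^y for y >= 0 and at most y^2 for y < 0. *)
Lemma exp_taylor1_bound (y : R) : Rabs (exp y - 1 - y) <= y ^ 2 * exp (Rabs y).
Proof.
  pose proof (exp_ineq1_le y). pose proof (exp_ineq1_le (- y)).
  assert (E : exp y * exp (- y) = 1) by (rewrite <- exp_plus, Rplus_opp_r; apply exp_0).
  pose proof (exp_pos y).
  assert (exp y - 1 <= y * exp y) by nra.
  rewrite Rabs_pos_eq by lra.
  destruct (Rle_dec 0 y) as [Hy|Hy].
  - rewrite (Rabs_pos_eq y) by auto. nra.
  - assert (1 <= exp (Rabs y)).
    { pose proof (exp_ineq1_le (Rabs y)). pose proof (Rabs_pos y). lra. }
    nra.
Qed.

Lemma sqr_le_exp (y : R) : 0 <= y -> y ^ 2 <= 4 * exp y.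
Proof.
  intros Hy. replace y with (y / 2 + y / 2) at 2 by field. rewrite exp_plus.
  pose proof (exp_ineq1_le (y / 2)). nra.
Qed.

(** The factor [dir] is absorbed through y <= e^y at y = 2 s0 |dir|. *)
Lemma dominated_dir_ker (x a b u p q : R) :
  0 < x -> - 1 / 2 < a -> dominated (fun t => dir u p q t * ker x a b t).
Proof.
  intros Hx Ha.
  destruct (exp_dir_ker_le x a b u p q Hx Ha) as (s0 & P0 & x' & a' & b' & Hx' & Ha' & HM).
  apply (dominated_le _ (ker x' a' b')); [| |now apply dominated_ker].
  - intros t Ht. apply (continuous_mult (K := R_AbsRing));
      [now apply dir_continuous|now apply ker_continuous].
  - exists (/ (2 * s0)). intros t Ht. specialize (HM t Ht).
    apply Rmult_le_reg_l with (2 * s0); [lra|].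
    rewrite <- Rmult_assoc, Rinv_r, Rmult_1_l by lra.
    rewrite Rabs_mult, (Rabs_pos_eq (ker _ _ _ _)) by apply Rlt_le, ker_pos.
    pose proof (exp_ineq1_le (2 * s0 * Rabs (dir u p q t))).
    pose proof (ker_pos x a b t). nra.
Qed.

Lemma is_derive_quadratic_remainder (f : R -> R) (l s0 C : R) :
  0 < s0 ->
  (forall s, Rabs s <= s0 -> Rabs (f s - f 0 - s * l) <= C * s ^ 2) ->
  is_derive f 0 l.
Proof.
  intros P0 H. apply is_derive_Reals. intros e He.
  pose proof (Rabs_pos C).
  assert (Hd : 0 < Rmin s0 (e / (Rabs C + 1))).
  { apply Rmin_glb_lt; auto. apply Rdiv_lt_0_compat; lra. }
  exists (mkposreal _ Hd). intros h Hh Hhd. simpl in Hhd.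
  rewrite Rplus_0_l.
  assert (H1 := Rmin_l s0 (e / (Rabs C + 1))).
  assert (H2 := Rmin_r s0 (e / (Rabs C + 1))).
  assert (Hp : 0 < Rabs h) by now apply Rabs_pos_lt.
  replace ((f h - f 0) / h - l) with ((f h - f 0 - h * l) / h) by (field; auto).
  unfold Rdiv. rewrite Rabs_mult, Rabs_inv.
  apply Rmult_lt_reg_r with (Rabs h); auto.
  rewrite Rmult_assoc, Rinv_l, Rmult_1_r by lra.
  eapply Rle_lt_trans; [apply H; lra|].
  rewrite <- pow2_abs. pose proof (Rle_abs C).
  assert (E : e / (Rabs C + 1) * (Rabs C + 1) = e) by (field; lra).
  apply Rle_lt_trans with (Rabs C * Rabs h * Rabs h); [simpl; nra|].
  apply Rmult_lt_compat_r; auto. nra.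
Qed.

(** The pointwise remainder e^(s B) - 1 - s B, with B the value of [dir], is at most s^2 B^2 e^(s0
    |B|), and s0^2 B^2 <= 4 e^(s0 |B|). It is thus 4 s^2 / s0^2 times an integrable kernel
    independent of s, and integrating gives an explicit quadratic error for the integral. *)
Lemma is_derive_laplace_dir (x a b u p q : R) :
  0 < x -> - 1 / 2 < a ->
  is_derive (fun s => laplace (x + s * u) (a + s * p) (b + s * q)) 0
    (half_int (fun t => dir u p q t * ker x a b t)).
Proof.
  intros Hx Ha.
  destruct (exp_dir_ker_le x a b u p q Hx Ha) as (s0 & P0 & x' & a' & b' & Hx' & Ha' & HM).
  pose proof (dominated_ker x' a' b' Hx' Ha') as DM.
  pose proof (dominated_ker x a b Hx (Rlt_le _ _ Ha)) as DK.
  pose proof (dominated_dir_ker x a b u p q Hx Ha) as DD.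
  apply is_derive_quadratic_remainder with s0 (4 / s0 ^ 2 * half_int (ker x' a' b')); auto.
  intros s Hs.
  assert (Hexp : forall t, exp (Rabs (s * dir u p q t)) <= exp (s0 * Rabs (dir u p q t))).
  { intros t. apply exp_le. rewrite Rabs_mult. apply Rmult_le_compat_r; auto.
    apply Rabs_pos. }
  assert (DS : dominated (ker (x + s * u) (a + s * p) (b + s * q))).
  { apply (dominated_le _ (ker x' a' b')); auto.
    - intros; now apply ker_continuous.
    - exists 1. intros t Ht. rewrite Rabs_pos_eq by apply Rlt_le, ker_pos.
      rewrite Rmult_1_l, ker_dir. eapply Rle_trans; [|now apply HM].
      apply Rmult_le_compat_r; [apply Rlt_le, ker_pos|].
      eapply Rle_trans; [apply exp_le, Rle_abs|]. eapply Rle_trans; [apply Hexp|].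
      apply exp_le. pose proof (Rabs_pos (dir u p q t)). nra. }
  assert (D1 := dominated_scal (-1) _ DK). assert (D2 := dominated_scal (- s) _ DD).
  assert (D3 := dominated_plus _ _ D1 D2). cbv beta in D3.
  rewrite !Rmult_0_l, !Rplus_0_r. unfold laplace.
  replace (half_int (ker (x + s * u) (a + s * p) (b + s * q)) - half_int (ker x a b)
    - s * half_int (fun t => dir u p q t * ker x a b t))
  with (half_int (fun t => ker (x + s * u) (a + s * p) (b + s * q) t
     + ((-1) * ker x a b t + (- s) * (dir u p q t * ker x a b t)))).
  2: { rewrite (half_int_plus _ _ DS D3), (half_int_plus _ _ D1 D2), !half_int_scal by auto.
       ring. }
  replace (4 / s0 ^ 2 * half_int (ker x' a' b') * s ^ 2)
    with (half_int (fun t => (4 / s0 ^ 2 * s ^ 2) * ker x' a' b' t))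
    by (rewrite half_int_scal by auto; ring).
  apply half_int_abs_le; [exact (dominated_plus _ _ DS D3)|exact (dominated_scal _ _ DM)|].
  intros t Ht. rewrite ker_dir. set (B := dir u p q t) in *.
  replace (exp (s * B) * ker x a b t + (-1 * ker x a b t + - s * (B * ker x a b t)))
    with ((exp (s * B) - 1 - s * B) * ker x a b t) by ring.
  rewrite Rabs_mult, (Rabs_pos_eq (ker _ _ _ _)) by apply Rlt_le, ker_pos.
  pose proof (ker_pos x a b t) as HK.
  apply Rle_trans with ((s * B) ^ 2 * exp (s0 * Rabs B) * ker x a b t).
  { apply Rmult_le_compat_r; [lra|]. eapply Rle_trans; [apply exp_taylor1_bound|].
    apply Rmult_le_compat_l; [apply pow2_ge_0|apply Hexp]. }
  apply Rle_trans with (4 / s0 ^ 2 * s ^ 2 * (exp (2 * s0 * Rabs B) * ker x a b t)).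
  2: { apply Rmult_le_compat_l; [|now apply HM].
       apply Rmult_le_pos; [|apply pow2_ge_0].
       apply Rlt_le, Rdiv_lt_0_compat; [lra|]. now apply pow_lt. }
  rewrite <- !Rmult_assoc. apply Rmult_le_compat_r; [lra|].
  replace (2 * s0 * Rabs B) with (s0 * Rabs B + s0 * Rabs B) by ring.
  rewrite exp_plus, <- Rmult_assoc. apply Rmult_le_compat_r; [apply Rlt_le, exp_pos|].
  assert (HS := sqr_le_exp (s0 * Rabs B) (Rmult_le_pos _ _ (Rlt_le _ _ P0) (Rabs_pos B))).
  rewrite !Rpow_mult_distr, pow2_abs in *.
  apply Rmult_le_reg_l with (s0 ^ 2); [now apply pow_lt|].
  replace (s0 ^ 2 * (4 / s0 ^ 2 * s ^ 2 * exp (s0 * Rabs B)))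
    with (s ^ 2 * (4 * exp (s0 * Rabs B))) by (field; lra).
  replace (s0 ^ 2 * (s ^ 2 * B ^ 2)) with (s ^ 2 * (s0 ^ 2 * B ^ 2)) by ring.
  apply Rmult_le_compat_l; [apply pow2_ge_0|auto].
Qed.

(* Coquelicot leaves derivatives in [NormedModule.sort _ _], where [ring] finds no structure. *)
Ltac as_R_eq := match goal with |- @eq _ ?a ?b => change (@eq R a b) end.

(** This integral and the next are the partial derivatives of [laplace] in a and in b. *)
Definition laplace_ln (x a b : R) : R := half_int (fun t => ln t * ker x a b t).
Definition laplace_ln1p (x a b : R) : R := half_int (fun t => ln (1 + t) * ker x a b t).

Lemma ker_mul_t (x a b t : R) : 0 < t -> t * ker x a b t = ker x (a + 1) b t.
Proof.
  intros Ht. unfold ker. rewrite <- (exp_ln t) at 1 by auto. rewrite <- exp_plus.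
  f_equal. ring.
Qed.

Lemma ker_mul_1p (x a b t : R) : 0 < t -> (1 + t) * ker x a b t = ker x a (b + 1) t.
Proof.
  intros Ht. unfold ker. rewrite <- (exp_ln (1 + t)) at 1 by lra. rewrite <- exp_plus.
  f_equal. ring.
Qed.

Lemma dominated_ln_ker (x a b : R) :
  0 < x -> - 1 / 2 < a -> dominated (fun t => ln t * ker x a b t).
Proof.
  intros Hx Ha. eapply dominated_ext; [|apply (dominated_dir_ker x a b 0 1 0 Hx Ha)].
  intros t Ht. unfold dir. simpl. ring.
Qed.

Lemma dominated_ln1p_ker (x a b : R) :
  0 < x -> - 1 / 2 < a -> dominated (fun t => ln (1 + t) * ker x a b t).
Proof.
  intros Hx Ha. eapply dominated_ext; [|apply (dominated_dir_ker x a b 0 0 1 Hx Ha)].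
  intros t Ht. unfold dir. simpl. ring.
Qed.

Lemma half_int_dir (x a b u p q : R) :
  0 < x -> - 1 / 2 < a ->
  half_int (fun t => dir u p q t * ker x a b t) =
  - u * laplace x (a + 1) b + p * laplace_ln x a b + q * laplace_ln1p x a b.
Proof.
  intros Hx Ha.
  assert (K1 := dominated_ker x (a + 1) b Hx ltac:(lra)).
  assert (K2 := dominated_ln_ker x a b Hx Ha).
  assert (K3 := dominated_ln1p_ker x a b Hx Ha).
  assert (D1 := dominated_scal (- u) _ K1). assert (D2 := dominated_scal p _ K2).
  assert (D3 := dominated_scal q _ K3).
  assert (D4 := dominated_plus _ _ D1 D2).
  unfold laplace, laplace_ln, laplace_ln1p.
  rewrite <- (half_int_scal (- u) _ K1), <- (half_int_scal p _ K2), <- (half_int_scal q _ K3).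
  rewrite <- (half_int_plus _ _ D1 D2), <- (half_int_plus _ _ D4 D3).
  apply half_int_ext. intros t Ht. rewrite <- ker_mul_t by auto. unfold dir. ring.
Qed.

Lemma is_derive_laplace_line (x a b u p q : R) :
  0 < x -> - 1 / 2 < a ->
  is_derive (fun s => laplace (x + s * u) (a + s * p) (b + s * q)) 0
    (- u * laplace x (a + 1) b + p * laplace_ln x a b + q * laplace_ln1p x a b).
Proof.
  intros Hx Ha. rewrite <- half_int_dir by auto. now apply is_derive_laplace_dir.
Qed.

Lemma is_derive_laplace_x (x a b : R) :
  0 < x -> - 1 / 2 < a ->
  is_derive (fun y => laplace y a b) x (- laplace x (a + 1) b).
Proof.
  intros Hx Ha.
  assert (H := is_derive_laplace_line x a b 1 0 0 Hx Ha).
  apply (is_derive_ext (fun y => laplace (x + (y - x) * 1) (a + (y - x) * 0) (b + (y - x) * 0))).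
  { intros y. f_equal; ring. }
  assert (G : is_derive (fun y => y - x) x 1) by (auto_derive; auto; as_R_eq; ring).
  set (f := fun s => laplace (x + s * 1) (a + s * 0) (b + s * 0)) in *.
  replace 0 with (x - x) in H at 1 by ring.
  assert (K := is_derive_comp f (fun y => y - x) x _ _ H G).
  unfold scal in K; simpl in K; unfold mult in K; simpl in K.
  replace (- laplace x (a + 1) b) with (1 * (- (1) * laplace x (a + 1) b
    + 0 * laplace_ln x a b + 0 * laplace_ln1p x a b)) by ring.
  exact K.
Qed.

(** * Contiguity relations and integration by parts *)

Lemma laplace_split (x a b : R) :
  0 < x -> - 1 / 2 <= a -> laplace x a (b + 1) = laplace x a b + laplace x (a + 1) b.
Proof.
  intros Hx Ha. unfold laplace.
  rewrite <- half_int_plus by (apply dominated_ker; lra).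
  apply half_int_ext. intros t Ht. rewrite <- ker_mul_1p, <- ker_mul_t by auto. ring.
Qed.

Lemma is_lim_seq_exp_half_ln : is_lim_seq (fun N => exp (- ln (INR N + 1) / 2)) 0.
Proof.
  apply (is_lim_seq_ext (fun N => / sqrt (INR (S N)))).
  - intros N. rewrite S_INR. replace (- ln (INR N + 1) / 2) with (- (/ 2 * ln (INR N + 1))) by field.
    rewrite exp_Ropp. f_equal. pose proof (pos_INR N).
    change (sqrt (INR N + 1) = Rpower (INR N + 1) (/ 2)).
    rewrite Rpower_sqrt; auto. lra.
  - apply (is_lim_seq_incr_1 (fun N => / sqrt (INR N))).
    apply (is_lim_seq_inv _ p_infty); [|discriminate].
    apply (filterlim_comp _ _ _ INR sqrt _ (Rbar_locally p_infty)).
    + exact is_lim_seq_INR.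
    + exact filterlim_sqrt_p.
Qed.

(** Times u, the majorant becomes sqrt u / (1 + u) <= e^(-|ln u| / 2). Stating the hypothesis
    through |ln u| treats the two ends 1 / (N + 1) and N + 1 of the truncation alike, with decay (N
    + 1)^(-1/2). *)
Lemma dominated_boundary (h : R -> R) (u : nat -> R) :
  dominated h ->
  (forall N, 0 < u N /\ Rabs (ln (u N)) = ln (INR N + 1)) ->
  is_lim_seq (fun N => u N * h (u N)) 0.
Proof.
  intros (_ & C & Hb) Hu. apply is_lim_seq_abs_0.
  apply (is_lim_seq_le_le (fun _ => 0) _ (fun N => C * exp (- ln (INR N + 1) / 2))).
  - intros N. split; [apply Rabs_pos|]. destruct (Hu N) as (Hp & Hl).
    specialize (Hb _ Hp). rewrite Rabs_mult, (Rabs_pos_eq (u N)) by lra.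
    apply Rle_trans with (C * (u N * half_majorant (u N))); [nra|].
    assert (0 <= C).
    { apply Rnot_lt_le. intro. pose proof (Rabs_pos (h (u N))).
      pose proof (ker_pos 0 (-1/2) (-1) (u N)). unfold half_majorant in *. nra. }
    apply Rmult_le_compat_l; auto. unfold half_majorant. rewrite ker_mul_t by auto.
    apply exp_le. pose proof (ln_1p_le _ Hp). pose proof (ln_le_ln_1p _ Hp).
    rewrite <- Hl. unfold Rabs. destruct (Rcase_abs (ln (u N))); lra.
  - apply is_lim_seq_const.
  - evar_last; [apply is_lim_seq_scal_l, is_lim_seq_exp_half_ln|].
    simpl. f_equal. ring.
Qed.

Lemma Rabs_ln_upper (N : nat) : 0 < INR N + 1 /\ Rabs (ln (INR N + 1)) = ln (INR N + 1).
Proof.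
  pose proof (pos_INR N). split; [lra|]. apply Rabs_pos_eq.
  rewrite <- ln_1. apply ln_le; lra.
Qed.

Lemma Rabs_ln_lower (N : nat) :
  0 < / (INR N + 1) /\ Rabs (ln (/ (INR N + 1))) = ln (INR N + 1).
Proof.
  destruct (Rabs_ln_upper N) as (H & E). split; [now apply Rinv_0_lt_compat|].
  rewrite ln_Rinv by auto. now rewrite Rabs_Ropp.
Qed.

Lemma is_derive_ker (x a b t : R) : 0 < t ->
  is_derive (ker x a b) t (a * ker x (a - 1) b t + b * ker x a (b - 1) t - x * ker x a b t).
Proof.
  intros Ht.
  replace (ker x a b t) with (t * ker x (a - 1) b t)
    by (rewrite ker_mul_t by auto; f_equal; ring).
  replace (ker x (a - 1) b t) with (ker x a b t / t)
    by (apply Rmult_eq_reg_l with t; [|lra]; rewrite ker_mul_t by auto;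
        replace (a - 1 + 1) with a by ring; field; lra).
  replace (ker x a (b - 1) t) with (ker x a b t / (1 + t))
    by (apply Rmult_eq_reg_l with (1 + t); [|lra]; rewrite ker_mul_1p by auto;
        replace (b - 1 + 1) with b by ring; field; lra).
  unfold ker. auto_derive; [lra|]. field. lra.
Qed.

(** The integrand is the derivative of t^(a+1) (1 + t)^b e^(-x t), which is t times a dominated
    kernel and so vanishes at both ends. *)
Lemma laplace_parts (x a b : R) :
  0 < x -> - 1 / 2 <= a ->
  (a + 1) * laplace x a b + b * laplace x (a + 1) (b - 1) - x * laplace x (a + 1) b = 0.
Proof.
  intros Hx Ha.
  assert (D0 := dominated_ker x a b Hx Ha).
  assert (D1 := dominated_scal (a + 1) _ D0).
  assert (D2 := dominated_scal b _ (dominated_ker x (a + 1) (b - 1) Hx ltac:(lra))).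
  assert (D3 := dominated_scal (- x) _ (dominated_ker x (a + 1) b Hx ltac:(lra))).
  assert (D12 := dominated_plus _ _ D1 D2). assert (D := dominated_plus _ _ D12 D3).
  cbv beta in D12, D.
  assert (E : half_int (fun t => (a + 1) * ker x a b t + b * ker x (a + 1) (b - 1) t
    + - x * ker x (a + 1) b t) = 0 - 0).
  { apply half_int_derive with (ker x (a + 1) b); auto.
    - intros t Ht. evar_last; [now apply is_derive_ker|].
      replace (a + 1 - 1) with a by ring. ring.
    - apply (is_lim_seq_ext (fun N => / (INR N + 1) * ker x a b (/ (INR N + 1)))).
      + intros N. apply ker_mul_t. apply Rabs_ln_lower.
      + apply (dominated_boundary _ _ D0). apply Rabs_ln_lower.
    - apply (is_lim_seq_ext (fun N => (INR N + 1) * ker x a b (INR N + 1))).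
      + intros N. apply ker_mul_t. apply Rabs_ln_upper.
      + apply (dominated_boundary _ _ D0). apply Rabs_ln_upper. }
  rewrite (half_int_plus _ _ D12 D3), (half_int_plus _ _ D1 D2), !half_int_scal in E
    by (apply dominated_ker; lra).
  unfold laplace. lra.
Qed.

(** The limiting case a = -1 of the preceding identity: the term with the factor a + 1 is absent,
    and the boundary value 1 at t = 0 takes its place. *)
Lemma laplace_parts_0 (x b : R) :
  0 < x -> b * laplace x 0 (b - 1) - x * laplace x 0 b = - 1.
Proof.
  intros Hx.
  assert (D0 := dominated_ker x 0 b Hx ltac:(lra)).
  assert (D2 := dominated_scal b _ (dominated_ker x 0 (b - 1) Hx ltac:(lra))).
  assert (D3 := dominated_scal (- x) _ D0).
  assert (D := dominated_plus _ _ D2 D3). cbv beta in D.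
  assert (E : half_int (fun t => b * ker x 0 (b - 1) t + - x * ker x 0 b t) = 0 - 1).
  { apply half_int_derive with (ker x 0 b); auto.
    - intros t Ht. evar_last; [now apply is_derive_ker|]. ring.
    (* Dropping the summand 0 * ln t leaves an expression continuous at t = 0, so its limit is its
       value there. *)
    - apply (is_lim_seq_ext (fun N => exp (- (x * / (INR N + 1)) + b * ln (1 + / (INR N + 1))))).
      { intros N. unfold ker. f_equal. ring. }
      evar_last.
      { apply (is_lim_seq_continuous (fun s => exp (- (x * s) + b * ln (1 + s)))
          (fun N => / (INR N + 1)) 0).
        apply continuity_pt_filterlim.
        change (continuous (fun s => exp (- (x * s) + b * ln (1 + s))) 0).
        apply (ex_derive_continuous (K := R_AbsRing) (V := R_NormedModule)).
        auto_derive. lra.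
        apply (is_lim_seq_ext (fun N => / INR (S N))).
        { intros N. now rewrite S_INR. }
        apply (is_lim_seq_incr_1 (fun N => / INR N)).
        apply (is_lim_seq_inv _ p_infty); [exact is_lim_seq_INR|discriminate]. }
      f_equal. rewrite Rplus_0_r, ln_1, !Rmult_0_r, Ropp_0, Rplus_0_r. apply exp_0.
    - apply (is_lim_seq_le_le (fun _ => 0) _ (fun N => (INR N + 1) * ker x 0 b (INR N + 1))).
      + intros N. pose proof (ker_pos x 0 b (INR N + 1)). pose proof (pos_INR N). nra.
      + apply is_lim_seq_const.
      + apply (dominated_boundary _ _ D0). apply Rabs_ln_upper. }
  rewrite (half_int_plus _ _ D2 D3), !half_int_scal in E by (apply dominated_ker; lra).
  unfold laplace. lra.
Qed.

(** * Recessive solutions of second-order linear equations *)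

Lemma constant_on_half_line (f : R -> R) (y z : R) :
  (forall t, 0 < t -> is_derive f t 0) -> 0 < y -> 0 < z -> f y = f z.
Proof.
  intros Hf Hy Hz.
  assert (H : forall p q, 0 < p -> p < q -> f p = f q).
  { intros p q Hp Hq. apply (eq_is_derive (V := R_NormedModule)); auto.
    intros t Ht. apply Hf. lra. }
  destruct (Rtotal_order y z) as [L|[->|L]]; auto. symmetry; auto.
Qed.

Lemma is_lim_1_bounds (u : R -> R) :
  is_lim u p_infty 1 -> exists M, 0 < M /\ forall z, M <= z -> 1 / 2 <= u z <= 3 / 2.
Proof.
  intros H. apply is_lim_spec in H.
  destruct (H (mkposreal (1 / 2) ltac:(lra))) as (M & HM). simpl in HM.
  exists (Rmax 1 (M + 1)). pose proof (Rmax_l 1 (M + 1)). pose proof (Rmax_r 1 (M + 1)).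
  split; [lra|]. intros z Hz. specialize (HM z ltac:(lra)).
  apply Rabs_def2 in HM. lra.
Qed.

(* By Abel's formula the Wronskian of [w] and [v] is [c E], so that [(w / v)' = c E / v^2];
   as [E / v^2] stays away from zero, [w / v] could not converge unless [c = 0]. *)
Lemma recessive_unique (A B E w w1 v v1 : R -> R) (Z d : R) :
  (forall z, 0 < z -> is_derive w z (w1 z) /\ is_derive w1 z (A z * w1 z + B z * w z)) ->
  (forall z, 0 < z -> is_derive v z (v1 z) /\ is_derive v1 z (A z * v1 z + B z * v z)) ->
  (forall z, 0 < z -> is_derive E z (A z * E z)) ->
  (forall z, 0 < z -> 0 < v z /\ 0 < E z) ->
  0 < d -> (forall z, Z <= z -> d * v z ^ 2 <= E z) ->
  is_lim (fun z => w z / v z) p_infty 1 ->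
  forall z, 0 < z -> w z = v z.
Proof.
  intros Hw Hv HE Hp Hd HZ Hl.
  set (W := fun z => (w1 z * v z - w z * v1 z) / E z).
  assert (HW : forall z, 0 < z -> is_derive W z 0).
  { intros z Hz. destruct (Hw z Hz) as (a1 & a2). destruct (Hv z Hz) as (b1 & b2).
    pose proof (HE z Hz) as a3. destruct (Hp z Hz).
    unfold W. evar_last.
    - apply is_derive_div; [|exact a3|lra].
      apply (is_derive_minus (fun z => w1 z * v z) (fun z => w z * v1 z)).
      + apply (is_derive_mult w1 v); eauto. intros; apply Rmult_comm.
      + apply (is_derive_mult w v1); eauto. intros; apply Rmult_comm.
    - unfold minus, plus, opp, mult; simpl. field. lra. }
  set (c := W 1).
  set (u := fun z => w z / v z) in *.
  assert (Hu : forall z, 0 < z -> is_derive u z (c * (E z / v z ^ 2))).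
  { intros z Hz. destruct (Hw z Hz) as (a1 & a2). destruct (Hv z Hz) as (b1 & b2).
    destruct (Hp z Hz). unfold u. evar_last.
    - apply is_derive_div; eauto. lra.
    - unfold c. rewrite (constant_on_half_line W 1 z HW) by lra.
      unfold W. field. lra. }
  assert (Hc : c = 0).
  { destruct (Req_dec c 0) as [?|Hc0]; auto. exfalso.
    destruct (is_lim_1_bounds u Hl) as (M & HM & HMb).
    set (y := Rmax M Z). assert (Hy1 := Rmax_l M Z). assert (Hy2 := Rmax_r M Z).
    fold y in Hy1, Hy2.
    pose proof (Rabs_pos_lt c Hc0) as Hca.
    (* The interval is long enough for the mean value theorem to force |u z - u y| >= 2, while both
       values lie in [1/2, 3/2]. *)
    set (z := y + 2 / (Rabs c * d)).
    assert (Hcd : 0 < Rabs c * d) by now apply Rmult_lt_0_compat.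
    assert (0 < 2 / (Rabs c * d)) by (apply Rdiv_lt_0_compat; lra).
    destruct (MVT_gen u y z (fun z => c * (E z / v z ^ 2))) as (t & Ht & Et).
    - intros t Ht. apply Hu. rewrite Rmin_left in Ht; unfold z in *; lra.
    - intros t Ht. rewrite Rmin_left in Ht by (unfold z; lra).
      apply continuity_pt_filterlim.
      apply (ex_derive_continuous (K := R_AbsRing) (V := R_NormedModule)).
      eexists. apply Hu. lra.
    - rewrite Rmin_left in Ht by (unfold z; lra).
      destruct (Hp t ltac:(lra)) as (vp & Ep).
      assert (Hq : d <= E t / v t ^ 2).
      { specialize (HZ t ltac:(lra)). apply Rmult_le_reg_r with (v t ^ 2).
        - now apply pow_lt.
        - replace (E t / v t ^ 2 * v t ^ 2) with (E t) by (field; lra). auto. }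
      pose proof (HMb y Hy1). pose proof (HMb z ltac:(unfold z; lra)).
      assert (Habs : Rabs (u z - u y) <= 1) by (apply Rabs_le; lra).
      rewrite Et in Habs.
      replace (z - y) with (2 / (Rabs c * d)) in Habs by (unfold z; ring).
      rewrite !Rabs_mult, (Rabs_pos_eq (2 / _)), (Rabs_pos_eq (E t / _)) in Habs by lra.
      assert (Rabs c * d * (2 / (Rabs c * d)) = 2) by (field; lra).
      assert (Rabs c * d * (2 / (Rabs c * d)) <=
              Rabs c * (E t / v t ^ 2) * (2 / (Rabs c * d))).
      { apply Rmult_le_compat_r; [lra|]. apply Rmult_le_compat_l; lra. }
      lra. }
  intros z Hz.
  assert (Hu1 : forall y, 0 < y -> u y = u z).
  { intros y Hy. apply constant_on_half_line; auto.
    intros t Ht. evar_last; [now apply Hu|]. rewrite Hc. simpl. as_R_eq. ring. }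
  assert (Hz1 : is_lim u p_infty (u z)).
  { apply (is_lim_ext_loc (fun _ => u z)); [|apply is_lim_const].
    exists 0. intros y Hy. symmetry. now apply Hu1. }
  assert (Eq : u z = 1).
  { apply is_lim_unique in Hl. apply is_lim_unique in Hz1. rewrite Hz1 in Hl. congruence. }
  destruct (Hp z Hz). unfold u in Eq.
  apply Rmult_eq_reg_r with (/ v z); [|apply Rinv_neq_0_compat; lra].
  rewrite Rinv_r by lra. exact Eq.
Qed.

(** Links explicit derivatives with the iterated [Derive] of the definitions: [Derive v] agrees with
    v1 on the half-line, hence locally around each of its points, which suffices for the second
    derivative. *)
Lemma Derive2_half_line (v v1 v2 : R -> R) :
  (forall z, 0 < z -> is_derive v z (v1 z)) ->
  (forall z, 0 < z -> is_derive v1 z (v2 z)) ->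
  forall z, 0 < z ->
    ex_derive v z /\ Derive v z = v1 z /\ is_derive (Derive v) z (v2 z).
Proof.
  intros H1 H2 z Hz. split; [|split].
  - exists (v1 z). auto.
  - apply is_derive_unique; auto.
  - apply (is_derive_ext_loc v1); [|now apply H2].
    exists (mkposreal z Hz). intros y Hy.
    apply Rabs_def2 in Hy. unfold minus, plus, opp in Hy; simpl in Hy.
    symmetry. apply is_derive_unique, H1. lra.
Qed.

(** A certificate for [is_tricomi] with the derivatives as data; positivity allows any other
    candidate to be divided by v. *)
Definition positive_tricomi (a b : R) (v v1 v2 : R -> R) : Prop :=
  (forall z, 0 < z -> 0 < v z /\ is_derive v z (v1 z) /\ is_derive v1 z (v2 z) /\
    z * v2 z + (b - z) * v1 z - a * v z = 0) /\
  is_lim (fun z => Rpower z a * v z) p_infty 1.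

Lemma Rpower_pos (x y : R) : 0 < Rpower x y.
Proof. apply exp_pos. Qed.

Lemma exp_dominates_power (c : R) :
  exists Z, 0 < Z /\ forall z, Z <= z -> 1 <= exp (z + c * ln z).
Proof.
  destruct (ln_1p_sublinear (Rabs c) (1 / 2) ltac:(lra)) as (K & HK).
  exists (Rmax 1 (2 * K)). pose proof (Rmax_l 1 (2 * K)). pose proof (Rmax_r 1 (2 * K)).
  split; [lra|]. intros z Hz. rewrite <- exp_0. apply exp_le.
  assert (Hz0 : 0 < z) by lra. specialize (HK z Hz0).
  assert (0 <= ln z <= ln (1 + z)).
  { split; [rewrite <- ln_1; apply ln_le; lra|now apply ln_le_ln_1p]. }
  pose proof (Rabs_pos c). assert (- c <= Rabs c) by (rewrite <- Rabs_Ropp; apply Rle_abs).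
  nra.
Qed.

(** The Wronskian of Kummer's equation is a multiple of e^z z^(-b), while v^2 behaves like z^(-2a);
    their quotient grows like e^z z^(2a-b), so [recessive_unique] applies and the description by
    [iota] has exactly one candidate. *)
Lemma tricomiU_eq (a b : R) (v v1 v2 : R -> R) (x : R) :
  positive_tricomi a b v v1 v2 -> 0 < x -> tricomiU a b x = v x.
Proof.
  intros (Hv & Hl) Hx.
  assert (HT : is_tricomi a b v).
  { split; auto. intros z Hz.
    destruct (Derive2_half_line v v1 v2 ltac:(intros; now apply Hv)
      ltac:(intros; now apply Hv) z Hz) as (e1 & e2 & e3).
    split; auto. split; [eexists; eauto|].
    rewrite e2, (is_derive_unique _ _ _ e3). now apply Hv. }
  assert (HU : forall w, is_tricomi a b w -> w x = v x).
  { intros w (Hw & Hwl).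
    destruct (is_lim_1_bounds _ Hl) as (M & HM & HMb).
    destruct (exp_dominates_power (2 * a - b)) as (Z & HZ & HZb).
    apply (recessive_unique (fun z => (z - b) / z) (fun z => a / z)
      (fun z => exp (z - b * ln z)) w (Derive w) v v1 (Rmax M Z) (1 / 4)); auto; try lra.
    - intros z Hz. destruct (Hw z Hz) as (e1 & e2 & e3).
      split; [now apply Derive_correct|]. evar_last; [now apply Derive_correct|].
      simpl. as_R_eq. apply Rmult_eq_reg_l with z; [|lra].
      transitivity ((z - b) * Derive w z + a * w z); [lra|]. field. lra.
    - intros z Hz. destruct (Hv z Hz) as (e0 & e1 & e2 & e3). split; auto.
      evar_last; [exact e2|].
      simpl. as_R_eq. apply Rmult_eq_reg_l with z; [|lra].
      transitivity ((z - b) * v1 z + a * v z); [lra|]. field. lra.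
    - intros z Hz. auto_derive; [lra|]. as_R_eq. unfold Rminus. field. lra.
    - intros z Hz. split; [now apply Hv|apply exp_pos].
    - intros z Hz. pose proof (Rmax_l M Z). pose proof (Rmax_r M Z).
      specialize (HMb z ltac:(lra)). specialize (HZb z ltac:(lra)).
      pose proof (Rpower_pos z a) as Pp. destruct (Hv z ltac:(lra)) as (Pv & _).
      (* After this multiplication the left side is (z^a v)^2 / 4 <= 9/16 and the right side is e^z
         z^(2a-b) >= 1. *)
      apply Rmult_le_reg_l with (Rpower z a ^ 2); [now apply pow_lt|].
      replace (Rpower z a ^ 2 * (1 / 4 * v z ^ 2))
        with (1 / 4 * (Rpower z a * v z) ^ 2) by ring.
      replace (Rpower z a ^ 2 * exp (z - b * ln z)) with (exp (z + (2 * a - b) * ln z)).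
      + nra.
      + unfold Rpower. simpl. rewrite Rmult_1_r, <- !exp_plus. f_equal. ring.
    - apply (is_lim_ext_loc (fun z => (Rpower z a * w z) / (Rpower z a * v z))).
      + exists 0. intros z Hz. pose proof (Rpower_pos z a). destruct (Hv z Hz).
        field. lra.
      + evar_last; [apply is_lim_div; eauto|]; simpl; try discriminate.
        * intros E. injection E. lra.
        * easy.
        * f_equal. field. }
  unfold tricomiU.
  destruct (iota_correct (fun y => exists w, is_tricomi a b w /\ w x = y)) as (w & Hw & Hy).
  - exists (v x). split; [now exists v|].
    intros y (w & Hw & <-). symmetry. now apply HU.
  - transitivity (w x); [symmetry; exact Hy|now apply HU].
Qed.

(** This is z^(b-1) U(a, b, z) = U(a - b + 1, 2 - b, z): multiplication by z^(b-1) turns one Kummer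
    operator into the other and respects the normalisation at infinity. *)
Lemma kummer_transformation (a b : R) (v v1 v2 : R -> R) :
  positive_tricomi a b v v1 v2 ->
  let e := b - 1 in
  positive_tricomi (a - e) (1 - e)
    (fun z => Rpower z e * v z)
    (fun z => Rpower z e * (v1 z + e * v z / z))
    (fun z => Rpower z e * (v2 z + 2 * e * v1 z / z + e * (e - 1) * v z / z ^ 2)).
Proof.
  intros (Hv & Hl) e. split.
  - intros z Hz. destruct (Hv z Hz) as (e0 & e1 & e2 & e3).
    assert (HP : is_derive (fun z => Rpower z e) z (Rpower z e * (e / z))).
    { unfold Rpower. auto_derive; [lra|]. as_R_eq. field. lra. }
    split; [apply Rmult_lt_0_compat; auto; apply Rpower_pos|].
    split; [|split].
    + evar_last; [apply (is_derive_mult (fun z => Rpower z e) v); eauto;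
        intros; apply Rmult_comm|].
      unfold plus, mult; simpl. as_R_eq. field. lra.
    + evar_last.
      * apply (is_derive_mult (fun z => Rpower z e) (fun z => v1 z + e * v z / z)); eauto;
          [|intros; apply Rmult_comm].
        apply (is_derive_plus v1 (fun z => e * v z / z)); eauto.
        apply (is_derive_div (fun z => e * v z) (fun z => z)); [|apply is_derive_id|lra].
        apply is_derive_scal; eauto.
      * unfold plus, mult, one; simpl. as_R_eq. unfold mult; simpl. field. lra.
    + transitivity (Rpower z e * (z * v2 z + (b - z) * v1 z - a * v z)).
      * unfold e. field. lra.
      * rewrite e3. ring.
  - apply (is_lim_ext_loc (fun z => Rpower z a * v z)); auto.
    exists 0. intros z Hz. rewrite <- Rmult_assoc, <- Rpower_plus.
    do 2 f_equal. ring.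
Qed.

(** * Integral representation of U, W and K *)

(** The substitution t -> t / z would move the truncation points; instead the left side has zero
    derivative in z, by [laplace_parts] with b = 0. The constant [laplace 1 a 0] is Gamma(a + 1). *)
Lemma laplace_scaling (z a : R) :
  0 < z -> - 1 / 2 < a -> Rpower z (a + 1) * laplace z a 0 = laplace 1 a 0.
Proof.
  intros Hz Ha.
  transitivity (Rpower 1 (a + 1) * laplace 1 a 0).
  2: { unfold Rpower. rewrite ln_1, Rmult_0_r, exp_0. ring. }
  apply (constant_on_half_line (fun z => Rpower z (a + 1) * laplace z a 0)); try lra.
  intros t Ht.
  assert (HP : is_derive (fun z => Rpower z (a + 1)) t (Rpower t (a + 1) * ((a + 1) / t))).
  { unfold Rpower. auto_derive; [lra|]. as_R_eq. field. lra. }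
  evar_last.
  - apply (is_derive_mult (fun z => Rpower z (a + 1)) (fun z => laplace z a 0)); eauto.
    + now apply is_derive_laplace_x.
    + intros; apply Rmult_comm.
  - unfold plus, mult; simpl. as_R_eq.
    assert (H := laplace_parts t a 0 Ht ltac:(lra)).
    rewrite Rmult_0_l in H.
    replace (laplace t (a + 1) 0) with ((a + 1) * laplace t a 0 / t); [field; lra|].
    apply Rmult_eq_reg_l with t; [|lra].
    transitivity ((a + 1) * laplace t a 0); [field|]; lra.
Qed.

Lemma Rabs_exp_m1_le (y : R) : Rabs (exp y - 1) <= Rabs y * exp (Rabs y).
Proof.
  pose proof (exp_ineq1_le y). pose proof (exp_ineq1_le (- y)).
  assert (E : exp y * exp (- y) = 1) by (rewrite <- exp_plus, Rplus_opp_r; apply exp_0).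
  pose proof (exp_pos y).
  destruct (Rle_dec 0 y) as [Hy|Hy].
  - rewrite (Rabs_pos_eq y) by auto. apply Rabs_le. nra.
  - rewrite (Rabs_left y) by lra. apply Rabs_le.
    pose proof (exp_ineq1_le (- y)).
    assert (exp y <= 1) by (rewrite <- exp_0; apply exp_le; lra). nra.
Qed.

(** Watson's lemma to leading order: replacing (1 + t)^c by 1 costs at most |c| t e^(t/2 + K), and
    for z >= 1 the factor e^(t/2) uses up no more than half of the decay e^(-z t). By scaling, the
    error is a multiple of 1 / z after normalisation. *)
Lemma laplace_asymptotic (a c : R) :
  - 1 / 2 < a ->
  is_lim (fun z => Rpower z (a + 1) * laplace z a c) p_infty (laplace 1 a 0).
Proof.
  intros Ha.
  destruct (ln_1p_sublinear (Rabs c) (1 / 2) ltac:(lra)) as (K & HK).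
  pose proof (Rabs_pos c) as Hc.
  (* The power of 2 comes from evaluating the scaling law, with exponent a + 1, at z / 2. *)
  set (D := Rabs c * (exp K * (Rpower 2 (a + 2) * laplace 1 (a + 1) 0))).
  assert (HD : 0 <= D).
  { unfold D. pose proof (laplace_pos 1 (a + 1) 0 Rlt_0_1 ltac:(lra)).
    pose proof (exp_pos K). pose proof (Rpower_pos 2 (a + 2)).
    repeat apply Rmult_le_pos; lra. }
  assert (HB : forall z, 1 <= z ->
    Rabs (Rpower z (a + 1) * laplace z a c - laplace 1 a 0) <= D / z).
  { intros z Hz. rewrite <- (laplace_scaling z a) by lra.
    rewrite <- Rmult_minus_distr_l, Rabs_mult, (Rabs_pos_eq (Rpower _ _))
      by apply Rlt_le, Rpower_pos.
    assert (Hz0 : 0 < z) by lra.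
    assert (D0 := dominated_ker z a c Hz0 ltac:(lra)).
    assert (D1 := dominated_ker z a 0 Hz0 ltac:(lra)).
    assert (D2 := dominated_ker (z / 2) (a + 1) 0 ltac:(lra) ltac:(lra)).
    assert (D3 := dominated_scal (-1) _ D1).
    assert (S1 : Rabs (laplace z a c - laplace z a 0)
      <= Rabs c * exp K * laplace (z / 2) (a + 1) 0).
    { replace (laplace z a c - laplace z a 0)
        with (half_int (fun t => ker z a c t + -1 * ker z a 0 t))
        by (rewrite (half_int_plus _ _ D0 D3), (half_int_scal _ _ D1); unfold laplace; ring).
      unfold laplace at 1. rewrite <- (half_int_scal _ _ D2).
      apply half_int_abs_le; [exact (dominated_plus _ _ D0 D3)|exact (dominated_scal _ _ D2)|].
      intros t Ht. specialize (HK t Ht). pose proof (ln_1p_le t Ht) as Hl.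
      replace (ker z a c t + -1 * ker z a 0 t)
        with (ker z a 0 t * (exp (c * ln (1 + t)) - 1))
        by (unfold ker; rewrite Rmult_minus_distr_l, <- exp_plus;
            replace (- (z * t) + a * ln t + 0 * ln (1 + t) + c * ln (1 + t))
              with (- (z * t) + a * ln t + c * ln (1 + t)) by ring; ring).
      rewrite Rabs_mult, (Rabs_pos_eq (ker _ _ _ _)) by apply Rlt_le, ker_pos.
      apply Rle_trans with (ker z a 0 t * (Rabs c * t * exp (t / 2 + K))).
      - apply Rmult_le_compat_l; [apply Rlt_le, ker_pos|].
        eapply Rle_trans; [apply Rabs_exp_m1_le|].
        rewrite Rabs_mult, (Rabs_pos_eq (ln _)) by lra.
        apply Rmult_le_compat; [nra|apply Rlt_le, exp_pos|nra|]. apply exp_le. lra.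
      - rewrite <- ker_mul_t by auto.
        assert (E : ker z a 0 t * exp (t / 2 + K) <= exp K * ker (z / 2) a 0 t).
        { unfold ker. rewrite <- !exp_plus. apply exp_le. nra. }
        assert (0 <= Rabs c * t) by nra. nra. }
    apply Rle_trans with (Rpower z (a + 1) * (Rabs c * exp K * laplace (z / 2) (a + 1) 0)).
    { apply Rmult_le_compat_l; auto. apply Rlt_le, Rpower_pos. }
    apply Req_le. unfold D.
    rewrite <- (laplace_scaling (z / 2) (a + 1)) by lra.
    replace (a + 1 + 1) with (a + 2) by ring.
    assert (E : Rpower 2 (a + 2) * Rpower (z / 2) (a + 2) = Rpower z (a + 1) * z).
    { rewrite Rpower_mult_distr by lra. replace (2 * (z / 2)) with z by field.
      replace (a + 2) with (a + 1 + 1) by ring. now rewrite Rpower_plus, Rpower_1. }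
    transitivity (Rabs c * exp K * laplace (z / 2) (a + 1) 0
      * (Rpower 2 (a + 2) * Rpower (z / 2) (a + 2)) / z); [rewrite E; field; lra|].
    field. lra. }
  apply is_lim_spec. intros eps. exists (Rmax 1 (D / eps)). intros z Hz.
  pose proof (Rmax_l 1 (D / eps)). pose proof (Rmax_r 1 (D / eps)).
  pose proof (cond_pos eps) as He.
  eapply Rle_lt_trans; [apply HB; lra|].
  apply Rmult_lt_reg_r with z; [lra|].
  unfold Rdiv. rewrite Rmult_assoc, Rinv_l, Rmult_1_r by lra.
  apply Rmult_lt_reg_l with (/ eps); [now apply Rinv_0_lt_compat|].
  rewrite <- Rmult_assoc, Rinv_l, Rmult_1_l by lra. unfold Rdiv in *. lra.
Qed.

(** The classical integral for U, with Gamma(a) in the denominator. Each derivative in z raises the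
    power of t by one with a change of sign, and Kummer's equation is one integration by parts. *)
Lemma laplace_tricomi (a b : R) :
  1 / 2 < a ->
  positive_tricomi a b
    (fun z => laplace z (a - 1) (b - a - 1) / laplace 1 (a - 1) 0)
    (fun z => - laplace z a (b - a - 1) / laplace 1 (a - 1) 0)
    (fun z => laplace z (a + 1) (b - a - 1) / laplace 1 (a - 1) 0).
Proof.
  intros Ha. set (c := b - a - 1). set (G := laplace 1 (a - 1) 0).
  assert (HG : 0 < G) by (apply laplace_pos; lra).
  split.
  - intros z Hz. split; [|split; [|split]].
    + apply Rdiv_lt_0_compat; auto. apply laplace_pos; lra.
    + assert (H := is_derive_laplace_x z (a - 1) c Hz ltac:(lra)).
      replace (a - 1 + 1) with a in H by ring.
      evar_last; [apply (is_derive_scal_l (fun z => laplace z (a - 1) c) z _ (/ G) H)|].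
      reflexivity.
    + assert (H := is_derive_laplace_x z a c Hz ltac:(lra)).
      apply is_derive_opp in H.
      evar_last; [exact (is_derive_scal_l (fun z => - laplace z a c) z _ (/ G) H)|].
      unfold scal, opp; simpl; unfold mult; simpl. as_R_eq. unfold Rdiv. ring.
    (* Taken with exponent c + 1, so that splitting off one factor 1 + t leaves exactly the
       integrals with t^(a-1), t^a and t^(a+1) that make up v, v1 and v2. *)
    + assert (P := laplace_parts z (a - 1) (c + 1) Hz ltac:(lra)).
      assert (S1 := laplace_split z (a - 1) c Hz ltac:(lra)).
      assert (S2 := laplace_split z a c Hz ltac:(lra)).
      replace (a - 1 + 1) with a in * by ring. replace (c + 1 - 1) with c in P by ring.
      replace b with (a + c + 1) by (unfold c; ring).
      rewrite S1, S2 in P. field_simplify; [|lra].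
      apply Rmult_eq_reg_r with G; [|lra].
      unfold Rdiv. rewrite Rmult_assoc, Rinv_l, Rmult_1_r, Rmult_0_l by lra. lra.
  - assert (H := laplace_asymptotic (a - 1) c ltac:(lra)).
    apply (is_lim_scal_r _ (/ G)) in H.
    replace (a - 1 + 1) with a in H by ring.
    replace (Finite 1) with (Rbar_mult (laplace 1 (a - 1) 0) (/ G))
      by (simpl; f_equal; unfold G in *; field; lra).
    apply (is_lim_ext (fun z => Rpower z a * laplace z (a - 1) c * / G)); auto.
    intros z. unfold Rdiv. ring.
Qed.

Lemma whittakerW_laplace (kappa mu x : R) :
  0 < x -> kappa < mu ->
  whittakerW kappa mu x =
    exp (- x / 2) * (Rpower x (mu + 1 / 2)
    * (laplace x (mu - 1 / 2 - kappa) (mu - 1 / 2 + kappa) / laplace 1 (mu - 1 / 2 - kappa) 0)).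
Proof.
  intros Hx Hk. unfold whittakerW.
  rewrite (tricomiU_eq _ _ _ _ _ x (laplace_tricomi (1 / 2 + mu - kappa) (1 + 2 * mu)
    ltac:(lra)) Hx).
  replace (1 / 2 + mu - kappa - 1) with (mu - 1 / 2 - kappa) by field.
  replace (1 + 2 * mu - (1 / 2 + mu - kappa) - 1) with (mu - 1 / 2 + kappa) by field.
  ring.
Qed.

(** Kummer's transformation with b - 1 = 2 mu: the factor x^(2 mu) is exactly the ratio of the two
    prefactors. *)
Lemma whittakerW_opp (kappa mu x : R) :
  0 < x -> kappa < mu -> whittakerW kappa (- mu) x = whittakerW kappa mu x.
Proof.
  intros Hx Hk. unfold whittakerW.
  assert (H := laplace_tricomi (1 / 2 + mu - kappa) (1 + 2 * mu) ltac:(lra)).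
  rewrite (tricomiU_eq _ _ _ _ _ x H Hx).
  apply kummer_transformation in H. cbv zeta in H.
  replace (1 / 2 + mu - kappa - (1 + 2 * mu - 1)) with (1 / 2 + - mu - kappa) in H by field.
  replace (1 - (1 + 2 * mu - 1)) with (1 + 2 * - mu) in H by field.
  rewrite (tricomiU_eq _ _ _ _ _ x H Hx).
  replace (Rpower x (mu + 1 / 2))
    with (Rpower x (- mu + 1 / 2) * Rpower x (1 + 2 * mu - 1))
    by (rewrite <- Rpower_plus; f_equal; field).
  ring.
Qed.

(** This is K_nu(x) = sqrt pi (2x)^nu e^(-x) U(nu + 1/2, 2 nu + 1, 2x), obtained by the same
    uniqueness argument, now with Wronskian proportional to 1 / z. *)
Lemma besselK_eq (nu : R) (v v1 v2 : R -> R) (x : R) :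
  positive_tricomi (nu + 1 / 2) (2 * nu + 1) v v1 v2 -> 0 < x ->
  besselK nu x = sqrt PI * (Rpower (2 * x) nu * exp (- x)) * v (2 * x).
Proof.
  intros (Hv & Hl) Hx.
  set (m := fun z => sqrt PI * (Rpower (2 * z) nu * exp (- z))).
  assert (HPI : 0 < sqrt PI) by apply sqrt_lt_R0, PI_RGT_0.
  assert (Hm : forall z, 0 < z -> is_derive m z (m z * (nu / z - 1))).
  { intros z Hz. unfold m, Rpower. auto_derive; [lra|]. as_R_eq. field. lra. }
  assert (Hm0 : forall z, 0 < m z).
  { intros z. unfold m. pose proof (Rpower_pos (2 * z) nu). pose proof (exp_pos (- z)).
    repeat apply Rmult_lt_0_compat; auto. }
  set (k := fun z => m z * v (2 * z)).
  set (k1 := fun z => m z * ((nu / z - 1) * v (2 * z) + 2 * v1 (2 * z))).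
  set (k2 := fun z => m z * (((nu / z - 1) ^ 2 - nu / z ^ 2) * v (2 * z)
    + 4 * (nu / z - 1) * v1 (2 * z) + 4 * v2 (2 * z))).
  assert (Hsc : forall (f f1 : R -> R), (forall z, 0 < z -> is_derive f z (f1 z)) ->
    forall z, 0 < z -> is_derive (fun z => f (2 * z)) z (2 * f1 (2 * z))).
  { intros f f1 Hf z Hz.
    apply (is_derive_comp f (fun z => 2 * z) z (f1 (2 * z)) 2).
    - apply Hf; lra.
    - auto_derive; auto. as_R_eq. ring. }
  assert (Hv1 := Hsc v v1 ltac:(intros; now apply Hv)).
  assert (Hv2 := Hsc v1 v2 ltac:(intros; now apply Hv)).
  assert (Hk1 : forall z, 0 < z -> is_derive k z (k1 z)).
  { intros z Hz. evar_last.
    - apply (is_derive_mult m (fun z => v (2 * z))); eauto. intros; apply Rmult_comm.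
    - unfold plus, mult, k1; simpl. as_R_eq. ring. }
  assert (Hk2 : forall z, 0 < z -> is_derive k1 z (k2 z)).
  { intros z Hz. evar_last.
    - apply (is_derive_mult m (fun z => (nu / z - 1) * v (2 * z) + 2 * v1 (2 * z))); eauto.
      + apply (is_derive_plus (fun z => (nu / z - 1) * v (2 * z)) (fun z => 2 * v1 (2 * z))).
        * apply (is_derive_mult (fun z => nu / z - 1) (fun z => v (2 * z)) z (- nu / z ^ 2));
            eauto.
          -- auto_derive; [lra|]. as_R_eq. field. lra.
          -- intros; apply Rmult_comm.
        * apply (is_derive_scal (fun z => v1 (2 * z))). eauto.
      + intros; apply Rmult_comm.
    - unfold plus, mult, k2; simpl. as_R_eq. unfold mult; simpl. field. lra. }
  assert (Hode : forall z, 0 < z ->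
    z ^ 2 * k2 z + z * k1 z - (z ^ 2 + nu ^ 2) * k z = 0).
  { intros z Hz. destruct (Hv (2 * z) ltac:(lra)) as (_ & _ & _ & e).
    (* Bessel's operator applied to k is 2 z m(z) times Kummer's operator applied to v at 2 z. *)
    transitivity (2 * z * m z * (2 * z * v2 (2 * z)
      + (2 * nu + 1 - 2 * z) * v1 (2 * z) - (nu + 1 / 2) * v (2 * z))).
    - unfold k, k1, k2. field. lra.
    - rewrite e. ring. }
  assert (Hkl : is_lim (fun z => k z / (sqrt (PI / (2 * z)) * exp (- z))) p_infty 1).
  { apply (is_lim_ext_loc (fun z => Rpower (2 * z) (nu + 1 / 2) * v (2 * z))).
    - exists 0. intros z Hz. unfold k, m.
      rewrite sqrt_div by (pose proof PI_RGT_0; lra).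
      rewrite Rpower_plus. replace (1 / 2) with (/ 2) by field.
      rewrite Rpower_sqrt by lra.
      assert (0 < sqrt (2 * z)) by (apply sqrt_lt_R0; lra).
      pose proof (exp_pos (- z)). field. lra.
    - apply (is_lim_comp (fun y => Rpower y (nu + 1 / 2) * v y) (fun z => 2 * z)
        p_infty 1 p_infty); auto.
      + evar_last; [apply is_lim_scal_l, is_lim_id|].
        simpl. destruct (Rle_dec 0 2) as [h|h]; [|lra].
        destruct (Rle_lt_or_eq_dec 0 2 h); [reflexivity|lra].
      + exists 0. easy. }
  assert (HB : is_besselK nu k).
  { split; auto. intros z Hz.
    destruct (Derive2_half_line k k1 k2 Hk1 Hk2 z Hz) as (e1 & e2 & e3).
    split; auto. split; [eexists; eauto|].
    rewrite e2, (is_derive_unique _ _ _ e3). now apply Hode. }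
  assert (HU : forall w, is_besselK nu w -> w x = k x).
  { intros w (Hw & Hwl).
    destruct (is_lim_1_bounds _ Hkl) as (M & HM & HMb).
    apply (recessive_unique (fun z => - / z) (fun z => 1 + nu ^ 2 / z ^ 2)
      (fun z => / z) w (Derive w) k k1 M (/ (2 * PI))); auto.
    - intros z Hz. destruct (Hw z Hz) as (e1 & e2 & e3).
      split; [now apply Derive_correct|]. evar_last; [now apply Derive_correct|].
      simpl. as_R_eq. apply Rmult_eq_reg_l with (z ^ 2); [|apply pow_nonzero; lra].
      transitivity (- z * Derive w z + (z ^ 2 + nu ^ 2) * w z); [lra|]. field. lra.
    - intros z Hz. specialize (Hode z Hz). split; auto.
      evar_last; [now apply Hk2|].
      simpl. as_R_eq. apply Rmult_eq_reg_l with (z ^ 2); [|apply pow_nonzero; lra].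
      transitivity (- z * k1 z + (z ^ 2 + nu ^ 2) * k z); [lra|]. field. lra.
    - intros z Hz. auto_derive; [lra|]. as_R_eq. field. lra.
    - intros z Hz. split; [|now apply Rinv_0_lt_compat].
      apply Rmult_lt_0_compat; auto. apply Hv. lra.
    - pose proof PI_RGT_0. apply Rinv_0_lt_compat. lra.
    - intros z Hz. specialize (HMb z Hz). pose proof PI_RGT_0.
      assert (Hz0 : 0 < z) by lra.
      set (s := sqrt (PI / (2 * z))) in *. set (e := exp (- z)) in *.
      assert (Hs0 : 0 < s) by (apply sqrt_lt_R0, Rdiv_lt_0_compat; lra).
      assert (Hs : s ^ 2 = PI / (2 * z)).
      { apply pow2_sqrt, Rlt_le, Rdiv_lt_0_compat; lra. }
      assert (He0 : 0 < e) by apply exp_pos.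
      assert (He : e <= 1) by (unfold e; rewrite <- exp_0; apply exp_le; lra).
      assert (Hse : 0 < s * e) by now apply Rmult_lt_0_compat.
      (* With r^2 <= 4, s^2 = pi / (2 z) and e <= 1 one gets k^2 <= 2 pi / z, whence the constant 1
         / (2 pi). *)
      set (r := k z / (s * e)) in *.
      replace (k z) with (r * (s * e)) by (unfold r; field; lra).
      assert (Hr : r ^ 2 <= 4) by nra.
      assert (He2 : e ^ 2 <= 1) by nra.
      replace (/ (2 * PI) * (r * (s * e)) ^ 2) with (r ^ 2 * e ^ 2 / 4 * / z).
      2: { rewrite !Rpow_mult_distr, Hs. field. lra. }
      assert (0 < / z) by now apply Rinv_0_lt_compat.
      assert (r ^ 2 * e ^ 2 <= 4 * 1).
      { apply Rmult_le_compat; auto; apply pow2_ge_0. }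
      nra.
    - apply (is_lim_ext_loc (fun z => (w z / (sqrt (PI / (2 * z)) * exp (- z)))
        / (k z / (sqrt (PI / (2 * z)) * exp (- z))))).
      + exists 0. intros z Hz. pose proof PI_RGT_0.
        assert (0 < sqrt (PI / (2 * z))) by (apply sqrt_lt_R0, Rdiv_lt_0_compat; lra).
        pose proof (exp_pos (- z)).
        assert (0 < k z) by (apply Rmult_lt_0_compat; auto; apply Hv; lra).
        field. lra.
      + evar_last; [apply is_lim_div; eauto|]; simpl; try discriminate.
        * intros E. injection E. lra.
        * easy.
        * f_equal. field. }
  unfold besselK.
  destruct (iota_correct (fun y => exists w, is_besselK nu w /\ w x = y)) as (w & Hw & Hy).
  - exists (k x). split; [now exists k|].
    intros y (w & Hw & <-). symmetry. now apply HU.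
  - transitivity (w x); [symmetry; exact Hy|now apply HU].
Qed.

(** * Incomplete gamma functions *)

Lemma RInt_gen_upper (f Phi : R -> R) (x : R) :
  (forall t, x <= t -> is_derive Phi t (f t)) ->
  (forall t, x <= t -> continuous f t) ->
  is_lim Phi p_infty 0 ->
  RInt_gen f (at_point x) (Rbar_locally p_infty) = - Phi x.
Proof.
  intros HD HC HL.
  apply (is_RInt_gen_unique (V := R_CompleteNormedModule)).
  intros P HP.
  assert (HL1 : is_lim (fun b => Phi b - Phi x) p_infty (- Phi x)).
  { evar_last; [apply is_lim_minus'; [exact HL|apply is_lim_const]|].
    f_equal. ring. }
  apply (Filter_prod _ _ _ (fun a => a = x) (fun b => x < b /\ P (Phi b - Phi x))).
  - reflexivity.
  - apply filter_and; [now exists x|]. exact (HL1 P HP).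
  - intros a b -> (Hb & HPb). exists (Phi b - Phi x). split; auto.
    apply (is_RInt_derive Phi f); intros t Ht; cbn [fst snd] in Ht;
      rewrite Rmin_left in Ht by lra; [apply HD|apply HC]; lra.
Qed.

Lemma laplace_0 (x : R) (m : nat) :
  0 < x -> laplace x (INR m) 0 = INR (fact m) / x ^ (m + 1).
Proof.
  intros Hx. induction m as [|m IH].
  - assert (H := laplace_parts_0 x 0 Hx). rewrite Rmult_0_l in H. simpl.
    apply Rmult_eq_reg_l with x; [|lra].
    transitivity 1; [lra|field; lra].
  - pose proof (pos_INR m).
    assert (P := laplace_parts x (INR m) 0 Hx ltac:(lra)). rewrite Rmult_0_l in P.
    rewrite IH in P. rewrite S_INR.
    apply Rmult_eq_reg_l with x; [|lra].
    transitivity ((INR m + 1) * (INR (fact m) / x ^ (m + 1))); [lra|].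
    rewrite fact_simpl, mult_INR, S_INR. simpl. field. split; [|lra].
    apply pow_nonzero. lra.
Qed.

(** Differentiating e^(-t) F(t, m, -1) gives minus e^(-t) times F(t, m, -1) + F(t, m + 1, -1), and
    this sum is F(t, m, 0) = m! / t^(m+1) since the factors 1 + t cancel. *)
Lemma is_derive_exp_laplace (m : nat) (t : R) :
  0 < t ->
  is_derive (fun t => - (exp (- t) * laplace t (INR m) (-1) / INR (fact m))) t
    (exp (- t) / t ^ (m + 1)).
Proof.
  intros Ht. pose proof (pos_INR m). pose proof (INR_fact_lt_0 m).
  assert (HD := is_derive_laplace_x t (INR m) (-1) Ht ltac:(lra)).
  assert (HS := laplace_split t (INR m) (-1) Ht ltac:(lra)).
  replace (-1 + 1) with 0 in HS by ring. rewrite laplace_0 in HS by auto.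
  assert (HE : is_derive (fun t => exp (- t)) t (- exp (- t))).
  { auto_derive; auto. as_R_eq. ring. }
  assert (HM := is_derive_mult (fun t => exp (- t)) _ t _ _ HE HD
    ltac:(intros; apply Rmult_comm)).
  assert (HK := is_derive_scal_l _ t _ (- / INR (fact m)) HM).
  apply (is_derive_ext (fun t => scal (mult (exp (- t)) (laplace t (INR m) (-1)))
    (- / INR (fact m)))).
  { intros y. unfold scal, mult; simpl; unfold mult; simpl. as_R_eq. unfold Rdiv. ring. }
  evar_last; [exact HK|].
  unfold scal, plus, mult; simpl; unfold mult; simpl. as_R_eq.
  replace (laplace t (INR m + 1) (-1))
    with (INR (fact m) / t ^ (m + 1) - laplace t (INR m) (-1)) by lra.
  assert (0 < t ^ (m + 1)) by now apply pow_lt. field. split; lra.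
Qed.

Lemma is_lim_exp_laplace (m : nat) :
  is_lim (fun t => - (exp (- t) * laplace t (INR m) (-1) / INR (fact m))) p_infty 0.
Proof.
  pose proof (pos_INR m). pose proof (INR_fact_lt_0 m) as Hf.
  apply is_lim_spec. intros eps. exists (Rmax 1 (/ eps)). intros t Ht.
  pose proof (Rmax_l 1 (/ eps)). pose proof (Rmax_r 1 (/ eps)).
  pose proof (cond_pos eps) as He.
  assert (Hp : 0 < laplace t (INR m) (-1)) by (apply laplace_pos; lra).
  assert (HL : laplace t (INR m) (-1) <= INR (fact m) / t ^ (m + 1)).
  { rewrite <- laplace_0 by lra. apply laplace_le; lra. }
  pose proof (exp_pos (- t)).
  assert (He1 : exp (- t) <= 1) by (rewrite <- exp_0; apply exp_le; lra).
  rewrite Rminus_0_r, Rabs_Ropp, Rabs_pos_eq.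
  2: { apply Rmult_le_pos; [|now apply Rlt_le, Rinv_0_lt_compat]. nra. }
  apply Rle_lt_trans with (/ t).
  - apply Rmult_le_reg_r with (INR (fact m)); auto.
    unfold Rdiv. rewrite Rmult_assoc, Rinv_l, Rmult_1_r by lra.
    apply Rle_trans with (laplace t (INR m) (-1)); [nra|].
    eapply Rle_trans; [exact HL|]. unfold Rdiv. rewrite Rmult_comm.
    apply Rmult_le_compat_r; [lra|].
    apply Rinv_le_contravar; [lra|].
    rewrite pow_add, pow_1. assert (1 <= t ^ m) by (apply pow_R1_Rle; lra). nra.
  - rewrite <- (Rinv_inv eps). apply Rinv_lt_contravar; [|lra].
    apply Rmult_lt_0_compat; [now apply Rinv_0_lt_compat|lra].
Qed.

(** Stated for any f equal to the integrand on the half-line, to cover both [gamma_upper] and, with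
    m = 0, [expint_E1]. *)
Lemma RInt_gen_upper_laplace (f : R -> R) (m : nat) (x : R) :
  0 < x ->
  (forall t, 0 < t -> f t = exp (- t) / t ^ (m + 1)) ->
  RInt_gen f (at_point x) (Rbar_locally p_infty) =
    exp (- x) * laplace x (INR m) (-1) / INR (fact m).
Proof.
  intros Hx Hf.
  etransitivity; [apply (RInt_gen_upper _
    (fun t => - (exp (- t) * laplace t (INR m) (-1) / INR (fact m))))|as_R_eq; ring].
  - intros t Ht. rewrite Hf by lra. apply is_derive_exp_laplace. lra.
  - intros t Ht. apply (continuous_ext_loc _ (fun t => exp (- t) / t ^ (m + 1))).
    + exists (mkposreal x Hx). intros y Hy. symmetry. apply Hf.
      apply Rabs_def2 in Hy. unfold minus, plus, opp in Hy; simpl in Hy. lra.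
    + apply (ex_derive_continuous (K := R_AbsRing) (V := R_NormedModule)).
      auto_derive. apply pow_nonzero. lra.
  - apply is_lim_exp_laplace.
Qed.

Lemma gamma_upper_laplace (m : nat) (x : R) :
  0 < x ->
  gamma_upper (- Z.of_nat m) x = exp (- x) * laplace x (INR m) (-1) / INR (fact m).
Proof.
  intros Hx. unfold gamma_upper.
  apply (RInt_gen_upper_laplace (fun t => powerRZ t (- Z.of_nat m - 1) * exp (- t)) m x Hx).
  intros t Ht.
  replace (- Z.of_nat m - 1)%Z with (- Z.of_nat (m + 1))%Z by lia.
  rewrite powerRZ_neg', <- pow_powerRZ. unfold Rdiv. ring.
Qed.

Lemma expint_E1_laplace (x : R) :
  0 < x -> expint_E1 x = exp (- x) * laplace x 0 (-1).
Proof.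
  intros Hx. unfold expint_E1.
  etransitivity; [apply (RInt_gen_upper_laplace (fun t => exp (- t) / t) 0 x Hx)|].
  - intros t Ht. simpl. now rewrite Rmult_1_r.
  - simpl. as_R_eq. field.
Qed.

Lemma gamma_lower_nat (m : nat) (z : R) :
  gamma_lower (Z.of_nat (S m)) z = RInt (fun t => t ^ m * exp (- t)) 0 z.
Proof.
  unfold gamma_lower. apply RInt_ext. intros t _.
  replace (Z.of_nat (S m) - 1)%Z with (Z.of_nat m) by lia.
  now rewrite <- pow_powerRZ.
Qed.

Lemma continuous_pow_exp (m : nat) (t : R) : continuous (fun t => t ^ m * exp (- t)) t.
Proof.
  apply (ex_derive_continuous (K := R_AbsRing) (V := R_NormedModule)).
  auto_derive. auto.
Qed.

Lemma ex_RInt_pow_exp (m : nat) (a b : R) : ex_RInt (fun t => t ^ m * exp (- t)) a b.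
Proof.
  apply (ex_RInt_continuous (V := R_CompleteNormedModule)).
  intros; apply continuous_pow_exp.
Qed.

Lemma gamma_lower_1 (z : R) : gamma_lower 1 z = 1 - exp (- z).
Proof.
  rewrite (gamma_lower_nat 0). apply is_RInt_unique.
  evar_last.
  - apply (is_RInt_derive (fun t => - exp (- t))).
    + intros t _. auto_derive; auto. as_R_eq. simpl. ring.
    + intros; apply continuous_pow_exp.
  - unfold minus, plus, opp; simpl. rewrite Ropp_0, exp_0. as_R_eq. ring.
Qed.

Lemma gamma_lower_S (m : nat) (z : R) :
  gamma_lower (Z.of_nat (S (S m))) z =
  INR (S m) * gamma_lower (Z.of_nat (S m)) z - z ^ (S m) * exp (- z).
Proof.
  rewrite !gamma_lower_nat.
  assert (E : is_RInt (fun t => t ^ S m * exp (- t) - INR (S m) * (t ^ m * exp (- t))) 0 z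
    (- (z ^ S m * exp (- z)) - - (0 ^ S m * exp (- 0)))).
  { apply (is_RInt_derive (fun t => - (t ^ S m * exp (- t)))).
    - intros t _. auto_derive; auto. as_R_eq.
      change (match m with 0%nat => 1 | S _ => INR m + 1 end) with (INR (S m)). simpl (_ ^ S m).
      ring.
    - intros t _. apply (continuous_minus (V := R_NormedModule) (fun t => t ^ S m * exp (- t))).
      + apply continuous_pow_exp.
      + apply (continuous_scal_r (INR (S m)) (fun t => t ^ m * exp (- t))).
        apply continuous_pow_exp. }
  assert (C1 := RInt_correct (V := R_CompleteNormedModule) _ _ _ (ex_RInt_pow_exp (S m) 0 z)).
  assert (C0 := RInt_correct (V := R_CompleteNormedModule) _ _ _ (ex_RInt_pow_exp m 0 z)).
  assert (E2 := is_RInt_minus _ _ _ _ _ _ C1 (is_RInt_scal _ _ _ (INR (S m)) _ C0)).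
  assert (E3 := eq_trans
    (eq_sym (is_RInt_unique (V := R_CompleteNormedModule) _ _ _ _ E2))
    (is_RInt_unique (V := R_CompleteNormedModule) _ _ _ _ E)).
  change (RInt (fun t => t ^ S m * exp (- t)) 0 z
    - INR (S m) * RInt (fun t => t ^ m * exp (- t)) 0 z
    = - (z ^ S m * exp (- z)) - - (0 ^ S m * exp (- 0))) in E3.
  rewrite (pow_i (S m)) in E3 by lia. lra.
Qed.

Lemma is_RInt_sum_n (f : nat -> R -> R) (l : nat -> R) (a b : R) (m : nat) :
  (forall i, is_RInt (f i) a b (l i)) ->
  is_RInt (fun t => sum_n (fun i => f i t) m) a b (sum_n l m).
Proof.
  intros Hf. induction m as [|m IH].
  - rewrite sum_O. apply (is_RInt_ext (f 0%nat)); auto.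
    intros t _. now rewrite sum_O.
  - rewrite sum_Sn.
    apply (is_RInt_ext (fun t => plus (sum_n (fun i => f i t) m) (f (S m) t))).
    { intros t _. now rewrite sum_Sn. }
    apply (is_RInt_plus (V := R_NormedModule)); auto.
Qed.

Definition gamma_sum (m : nat) (x : R) : R :=
  sum_n_m (fun l : nat => Binomial.C m l * powerRZ (- x) (- Z.of_nat l)
    * gamma_lower (Z.of_nat l) x) 1 m.

(** Pascal's rule; the part with the lowered index is renumbered by i = l - 1. *)
Lemma gamma_sum_pascal (m : nat) (x : R) :
  gamma_sum (S m) x = gamma_sum m x + sum_n (fun i : nat => Binomial.C m i
    * powerRZ (- x) (- Z.of_nat (S i)) * gamma_lower (Z.of_nat (S i)) x) m.
Proof.
  set (b := fun l : nat => powerRZ (- x) (- Z.of_nat l) * gamma_lower (Z.of_nat l) x).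
  unfold gamma_sum.
  rewrite (sum_n_m_ext _ (fun l => Binomial.C m l * b l) 1 m) by (intros; unfold b; as_R_eq; ring).
  rewrite (sum_n_m_ext _ (fun l => Binomial.C (S m) l * b l) 1 (S m))
    by (intros; unfold b; as_R_eq; ring).
  rewrite (sum_n_ext _ (fun i => Binomial.C m (pred (S i)) * b (S i)))
    by (intros; unfold b; simpl pred; as_R_eq; ring).
  unfold sum_n. rewrite (sum_n_m_S (fun l => Binomial.C m (pred l) * b l)).
  (* The term l = m + 1 is split off: truncated subtraction gives [Binomial.C m (S m)] the value 1 /
     (m + 1) instead of 0, so Pascal's rule is applied to l <= m only. *)
  rewrite !(sum_n_Sm _ 1 m) by lia. simpl pred.
  assert (C1 : forall k, Binomial.C k k = 1).
  { intros k. unfold Binomial.C. rewrite Nat.sub_diag. simpl (INR (fact 0)).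
    field. apply INR_fact_neq_0. }
  rewrite !C1.
  rewrite (sum_n_m_ext_loc (fun l => Binomial.C (S m) l * b l)
    (fun l => plus (Binomial.C m l * b l) (Binomial.C m (pred l) * b l))).
  - rewrite sum_n_m_plus. unfold plus; simpl. as_R_eq. ring.
  - intros [|k] Hk; [lia|]. simpl pred. rewrite <- pascal by lia.
    unfold plus; simpl. as_R_eq. ring.
Qed.

(** Under one integral sign the increment is a binomial expansion; summing it and shifting the
    variable by x merges the m + 1 lower gamma functions at x into a single one at -x. *)
Lemma gamma_sum_S (m : nat) (x : R) :
  0 < x ->
  gamma_sum (S m) x = gamma_sum m x
    + (-1) ^ m * exp (- x) / x ^ (S m) * gamma_lower (Z.of_nat (S m)) (- x).
Proof.
  intros Hx. rewrite gamma_sum_pascal. f_equal. as_R_eq.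
  set (c := fun i => Binomial.C m i * powerRZ (- x) (- Z.of_nat (S i))).
  assert (E1 : forall i, is_RInt (fun t => c i * (t ^ i * exp (- t))) 0 x
    (c i * gamma_lower (Z.of_nat (S i)) x)).
  { intros i. rewrite gamma_lower_nat.
    apply (is_RInt_scal (fun t => t ^ i * exp (- t))).
    apply (RInt_correct (V := R_CompleteNormedModule)). apply ex_RInt_pow_exp. }
  assert (E2 := is_RInt_unique (V := R_CompleteNormedModule) _ _ _ _
    (is_RInt_sum_n _ _ 0 x m E1)).
  etransitivity; [symmetry; exact E2|]. clear E1 E2.
  rewrite gamma_lower_nat.
  (* With s = t - x, the binomial sum is - (1 - t / x)^m / x = - (- s / x)^m / x. *)
  set (g := fun s => s ^ m * exp (- s)).
  set (k := (-1) ^ m * exp (- x) / x ^ S m).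
  assert (E3 := RInt_comp_lin g 1 (- x) 0 x).
  replace (1 * 0 + - x) with (- x) in E3 by ring.
  replace (1 * x + - x) with 0 in E3 by ring.
  specialize (E3 (ex_RInt_pow_exp m (- x) 0)).
  assert (E4 := opp_RInt_swap g (- x) 0 (ex_RInt_pow_exp m (- x) 0)).
  unfold opp in E4; simpl in E4.
  change (- RInt g (- x) 0 = RInt g 0 (- x)) in E4.
  rewrite <- E4.
  transitivity (- k * RInt g (- x) 0); [|as_R_eq; ring].
  rewrite <- E3.
  assert (Hex : ex_RInt (fun y => scal 1 (g (1 * y + - x))) 0 x).
  { apply (ex_RInt_continuous (V := R_CompleteNormedModule)). intros z _.
    apply (ex_derive_continuous (K := R_AbsRing) (V := R_NormedModule)).
    unfold scal; simpl; unfold mult; simpl. unfold g. auto_derive. auto. }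
  assert (E5 := RInt_scal _ 0 x (- k) Hex).
  etransitivity; [|exact E5].
  apply RInt_ext. intros t _.
  unfold scal; simpl; unfold mult; simpl. as_R_eq.
  assert (E6 : sum_n (fun i => c i * (t ^ i * exp (- t))) m
    = (- / x * exp (- t)) * sum_n (fun i => Binomial.C m i * (- t / x) ^ i * 1 ^ (m - i)) m).
  { etransitivity; [|apply (sum_n_mult_l (K := R_Ring))].
    apply sum_n_ext. intros i. unfold mult; simpl. as_R_eq. unfold c.
    rewrite powerRZ_neg', <- pow_powerRZ, pow1.
    replace (- t / x) with (/ - x * t) by (field; lra).
    replace (- / x) with (/ - x) by (field; lra).
    assert (Hy : - x <> 0) by lra. set (y := - x) in *.
    rewrite Rpow_mult_distr, pow_inv. simpl. field.
    split; [|lra]. apply pow_nonzero. lra. }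
  etransitivity; [exact E6|].
  rewrite sum_n_Reals, <- binomial. unfold g, k.
  replace (- t / x + 1) with (-1 * / x * (1 * t + - x)) by (field; lra).
  rewrite !Rpow_mult_distr, pow_inv.
  replace (- (1 * t + - x)) with (x + - t) by ring. rewrite exp_plus, !exp_Ropp.
  pose proof (exp_pos x). pose proof (exp_pos t). simpl. field.
  repeat split; try lra. apply pow_nonzero. lra.
Qed.

(** * Recurrences of the logarithmic integrals *)

Lemma is_derive_laplace_b (x a b : R) :
  0 < x -> - 1 / 2 < a ->
  is_derive (fun s => laplace x a (b + s)) 0 (laplace_ln1p x a b).
Proof.
  intros Hx Ha. assert (H := is_derive_laplace_line x a b 0 0 1 Hx Ha).
  replace (laplace_ln1p x a b) with
    (- 0 * laplace x (a + 1) b + 0 * laplace_ln x a b + 1 * laplace_ln1p x a b) by ring.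
  eapply is_derive_ext; [|exact H]. intros s. simpl. f_equal; ring.
Qed.

Lemma is_derive_laplace_a (x a b : R) :
  0 < x -> - 1 / 2 < a ->
  is_derive (fun s => laplace x (a + s) b) 0 (laplace_ln x a b).
Proof.
  intros Hx Ha. assert (H := is_derive_laplace_line x a b 0 1 0 Hx Ha).
  replace (laplace_ln x a b) with
    (- 0 * laplace x (a + 1) b + 1 * laplace_ln x a b + 0 * laplace_ln1p x a b) by ring.
  eapply is_derive_ext; [|exact H]. intros s. simpl. f_equal; ring.
Qed.

Lemma is_derive_laplace_ab (x a b : R) :
  0 < x -> - 1 / 2 < a ->
  is_derive (fun s => laplace x (a - s) (b + s)) 0 (laplace_ln1p x a b - laplace_ln x a b).
Proof.
  intros Hx Ha. assert (H := is_derive_laplace_line x a b 0 (-1) 1 Hx Ha).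
  replace (laplace_ln1p x a b - laplace_ln x a b) with
    (- 0 * laplace x (a + 1) b + -1 * laplace_ln x a b + 1 * laplace_ln1p x a b) by ring.
  eapply is_derive_ext; [|exact H]. intros s. simpl. f_equal; ring.
Qed.

(** The device for differentiating an identity in an exponent. Local validity is enough, since an
    identity in a + s is available only while a + s stays above -1/2. *)
Lemma is_derive_const_eq (f : R -> R) (c l : R) :
  is_derive f 0 l -> locally 0 (fun s => f s = c) -> l = 0.
Proof.
  intros H Hc. apply is_derive_unique in H. rewrite <- H.
  transitivity (Derive (fun _ => c) 0); [now apply Derive_ext_loc|apply Derive_const].
Qed.

(** Derivative of [laplace_parts] in b at b = 0; the explicit factor b leaves the integral with (1 +
    t)^(-1) undifferentiated. *)
Lemma laplace_ln1p_rec (x a : R) :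
  0 < x -> - 1 / 2 < a ->
  x * laplace_ln1p x (a + 1) 0 = (a + 1) * laplace_ln1p x a 0 + laplace x (a + 1) (-1).
Proof.
  intros Hx Ha.
  assert (D1 := is_derive_laplace_b x a 0 Hx Ha).
  assert (D2 := is_derive_laplace_b x (a + 1) (-1) Hx ltac:(lra)).
  assert (D3 := is_derive_laplace_b x (a + 1) 0 Hx ltac:(lra)).
  assert (D1' := is_derive_scal _ _ (a + 1) _ D1).
  assert (D2' := is_derive_mult (fun s => s) _ 0 1 _ (is_derive_id 0) D2
    ltac:(intros; apply Rmult_comm)).
  assert (D3' := is_derive_scal _ _ x _ D3).
  assert (D := is_derive_minus _ _ _ _ _ (is_derive_plus _ _ _ _ _ D1' D2') D3').
  apply (is_derive_const_eq _ 0) in D.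
  - unfold minus, plus, opp, mult in D; simpl in D.
    replace (-1 + 0) with (-1) in D by ring. lra.
  - apply filter_forall. intros s.
    assert (P := laplace_parts x a s Hx ltac:(lra)).
    unfold minus, plus, opp, mult; simpl. rewrite !Rplus_0_l.
    replace (-1 + s) with (s - 1) by ring. lra.
Qed.

Lemma laplace_ln1p_0 (x : R) : 0 < x -> x * laplace_ln1p x 0 0 = laplace x 0 (-1).
Proof.
  intros Hx.
  assert (D2 := is_derive_laplace_b x 0 (-1) Hx ltac:(lra)).
  assert (D3 := is_derive_laplace_b x 0 0 Hx ltac:(lra)).
  assert (D2' := is_derive_mult (fun s => s) _ 0 1 _ (is_derive_id 0) D2
    ltac:(intros; apply Rmult_comm)).
  assert (D3' := is_derive_scal _ _ x _ D3).
  assert (D := is_derive_minus _ _ _ _ _ D2' D3').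
  apply (is_derive_const_eq _ (- 1)) in D.
  - unfold minus, plus, opp, mult in D; simpl in D.
    replace (-1 + 0) with (-1) in D by ring. lra.
  - apply filter_forall. intros s.
    assert (P := laplace_parts_0 x s Hx).
    unfold minus, plus, opp, mult; simpl. rewrite !Rplus_0_l.
    replace (-1 + s) with (s - 1) by ring. lra.
Qed.

(** Derivative in a of Gamma(a + 2) = (a + 1) Gamma(a + 1). *)
Lemma laplace_ln_1_rec (a : R) :
  - 1 / 2 < a ->
  laplace_ln 1 (a + 1) 0 = (a + 1) * laplace_ln 1 a 0 + laplace 1 a 0.
Proof.
  intros Ha.
  assert (D1 := is_derive_laplace_a 1 a 0 Rlt_0_1 Ha).
  assert (D2 := is_derive_laplace_a 1 (a + 1) 0 Rlt_0_1 ltac:(lra)).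
  assert (D0 : is_derive (fun s => a + 1 + s) 0 1) by (auto_derive; auto; as_R_eq; ring).
  assert (D1' := is_derive_mult _ _ 0 _ _ D0 D1 ltac:(intros; apply Rmult_comm)).
  assert (D := is_derive_minus _ _ _ _ _ D1' D2).
  apply (is_derive_const_eq _ 0) in D.
  - unfold minus, plus, opp, mult in D; simpl in D. rewrite !Rplus_0_r in D. lra.
  - assert (He : 0 < a + 1 / 2) by lra. exists (mkposreal _ He). intros s Hs.
    apply Rabs_def2 in Hs. unfold minus, plus, opp in Hs; simpl in Hs.
    assert (P := laplace_parts 1 (a + s) 0 Rlt_0_1 ltac:(lra)).
    unfold minus, plus, opp, mult; simpl.
    replace (a + 1 + s) with (a + s + 1) by ring. lra.
Qed.

(** Derivative in a of the scaling law; the power of x contributes the ln x of the final formula. *)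
Lemma laplace_ln_scaling (x a : R) :
  0 < x -> - 1 / 2 < a ->
  Rpower x (a + 1) * (ln x * laplace x a 0 + laplace_ln x a 0) = laplace_ln 1 a 0.
Proof.
  intros Hx Ha.
  assert (D1 := is_derive_laplace_a x a 0 Hx Ha).
  assert (D2 := is_derive_laplace_a 1 a 0 Rlt_0_1 ltac:(lra)).
  assert (D0 : is_derive (fun s => Rpower x (a + s + 1)) 0 (ln x * Rpower x (a + 1))).
  { unfold Rpower. auto_derive; auto. as_R_eq. rewrite Rplus_0_r. ring. }
  assert (D1' := is_derive_mult _ _ 0 _ _ D0 D1 ltac:(intros; apply Rmult_comm)).
  assert (D := is_derive_minus _ _ _ _ _ D1' D2).
  apply (is_derive_const_eq _ 0) in D.
  - unfold minus, plus, opp, mult in D; simpl in D. rewrite !Rplus_0_r in D. lra.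
  - assert (He : 0 < a + 1 / 2) by lra. exists (mkposreal _ He). intros s Hs.
    apply Rabs_def2 in Hs. unfold minus, plus, opp in Hs; simpl in Hs.
    assert (P := laplace_scaling x (a + s) Hx ltac:(lra)).
    unfold minus, plus, opp, mult; simpl. lra.
Qed.

(** This is Gamma'(m + 1) = m! (psi(1) + H_m), with psi(1) kept as the integral
    [laplace_ln 1 0 0]. *)
Lemma laplace_ln_1_nat (m : nat) :
  laplace_ln 1 (INR m) 0 = INR (fact m) * (laplace_ln 1 0 0 + harmonic m).
Proof.
  induction m as [|m IH].
  - unfold harmonic. rewrite sum_n_m_zero by lia. unfold zero; simpl. ring.
  - pose proof (pos_INR m). rewrite S_INR, laplace_ln_1_rec by lra.
    rewrite IH, laplace_0 by lra. rewrite pow1.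
    unfold harmonic. rewrite (sum_n_Sm _ 1 m) by lia. unfold plus; simpl (AbelianMonoid.plus _ _).
    rewrite fact_simpl, mult_INR, S_INR.
    change (AbelianMonoid.plus _ ?a ?b) with (a + b). field. lra.
Qed.

(** Both sides grow by x^(m+1) F(x, m + 1, -1) / (m+1)! from m to m + 1. On the right, the
    recurrences of the two gamma factors produce a multiple of gamma(m + 1, -x) that the increment
    of [gamma_sum] cancels; the boundary term of the lower gamma function remains. *)
Lemma laplace_ln1p_gamma (x : R) (m : nat) :
  0 < x ->
  x ^ (m + 1) / INR (fact m) * laplace_ln1p x (INR m) 0 =
  expint_E1 x
  + ((-1) ^ (m + 1) * gamma_upper (- Z.of_nat m) x * gamma_lower (Z.of_nat m + 1) (- x)
     - gamma_sum m x).
Proof.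
  intros Hx. rewrite expint_E1_laplace, gamma_upper_laplace by auto.
  replace (Z.of_nat m + 1)%Z with (Z.of_nat (S m)) by lia.
  assert (Hee : exp (- x) * exp x = 1) by (rewrite <- exp_plus, Rplus_opp_l; apply exp_0).
  induction m as [|m IH].
  - change (Z.of_nat 1) with 1%Z. rewrite gamma_lower_1, Ropp_involutive.
    unfold gamma_sum. rewrite sum_n_m_zero by lia. unfold zero; simpl.
    (* Base case: E_1(x) - Gamma(0, x) (1 - e^x) = e^x E_1(x), which is F(x, 0, -1). *)
    assert (H0 := laplace_ln1p_0 x Hx).
    replace (x * 1 / 1 * laplace_ln1p x 0 0) with (x * laplace_ln1p x 0 0) by field.
    rewrite H0. transitivity (laplace x 0 (-1) * (exp (- x) * exp x)); [rewrite Hee|]; field.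
  - pose proof (pos_INR m). pose proof (INR_fact_lt_0 m) as Hf.
    rewrite gamma_sum_S, gamma_lower_S by auto. rewrite Ropp_involutive.
    assert (HR := laplace_ln1p_rec x (INR m) Hx ltac:(lra)).
    assert (HS := laplace_split x (INR m) (-1) Hx ltac:(lra)).
    replace (-1 + 1) with 0 in HS by ring. rewrite laplace_0 in HS by auto.
    rewrite <- S_INR in *.
    set (L1 := laplace_ln1p x (INR (S m)) 0) in *.
    set (L0 := laplace_ln1p x (INR m) 0) in *.
    assert (Hq : laplace x (INR (S m)) (-1)
      = INR (fact m) / x ^ (m + 1) - laplace x (INR m) (-1)) by lra.
    rewrite Hq in *.
    set (q := laplace x (INR m) (-1)) in *.
    set (g := gamma_lower (Z.of_nat (S m)) (- x)) in *.
    set (s := (-1) ^ m).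
    assert (Hs : s * s = 1).
    { unfold s. rewrite <- Rpow_mult_distr. replace (-1 * -1) with 1 by ring. apply pow1. }
    assert (Hx1 : 0 < x ^ m) by now apply pow_lt.
    replace ((- x) ^ S m) with (- s * x * x ^ m)
      by (unfold s; replace (- x) with (-1 * x) by ring;
          rewrite Rpow_mult_distr; simpl; ring).
    rewrite !pow_add, !pow_1 in *. fold s in IH.
    assert (HSm : 0 < INR (S m)) by (rewrite S_INR; lra).
    rewrite fact_simpl, mult_INR. simpl (_ ^ S m). fold s.
    transitivity (x ^ m * x / INR (fact m) * L0
      + x * x ^ m / (INR (S m) * INR (fact m)) * (INR (fact m) / (x ^ m * x) - q)).
    { replace L1 with ((INR (S m) * L0 + (INR (fact m) / (x ^ m * x) - q)) / x)
        by (rewrite <- HR; field; lra).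
      field. repeat split; lra. }
    rewrite IH. set (G := gamma_sum m x).
    set (fm := INR (fact m)) in *. set (Sm := INR (S m)) in *. set (e := exp (- x)) in *.
    set (f := exp x) in *. set (y := x ^ m) in *.
    (* The factors s * s and e * f, both equal to 1, are inserted so that the rest is a rational
       identity in which the sign and the exponentials are free variables. *)
    transitivity (e * laplace x 0 (-1) + (s * -1 * (e * q / fm) * g - G)
      + (s * s) * (e * f) * (x * y / (Sm * fm) * (fm / (y * x) - q))).
    { rewrite Hs, Hee. ring. }
    field. repeat split; lra.
Qed.

(** * Finite sums and the binomial expansion of the integral *)

Lemma dominated_sum_n (f : nat -> R -> R) (m : nat) :
  (forall i, dominated (f i)) ->
  dominated (fun t => sum_n (fun i => f i t) m) /\
  half_int (fun t => sum_n (fun i => f i t) m) = sum_n (fun i => half_int (f i)) m.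
Proof.
  intros Hf. induction m as [|m (IHd & IHe)].
  - split.
    + apply (dominated_ext (f 0%nat)); auto. intros t _. now rewrite sum_O.
    + rewrite sum_O. apply half_int_ext. intros t _. now rewrite sum_O.
  - assert (HD := dominated_plus _ _ IHd (Hf (S m))).
    assert (HE : forall t, 0 < t -> sum_n (fun i => f i t) m + f (S m) t
      = sum_n (fun i => f i t) (S m)) by (intros t _; now rewrite sum_Sn).
    split.
    + eapply dominated_ext; [|exact HD]. exact HE.
    + rewrite sum_Sn, <- IHe. rewrite <- (half_int_ext _ _ HE).
      apply (half_int_plus _ _ IHd (Hf (S m))).
Qed.

Lemma ker_mul_pow (x a b t : R) (i : nat) :
  0 < t -> t ^ i * ker x a b t = ker x (a + INR i) b t.
Proof.
  intros Ht. rewrite <- Rpower_pow by auto. unfold Rpower, ker.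
  rewrite <- exp_plus. f_equal. ring.
Qed.

(** Only the integer part n of the exponent is expanded; the real remainder b stays free and carries
    kappa, or is 0 for the Bessel function. *)
Lemma laplace_binomial (x a b : R) (n : nat) :
  0 < x -> - 1 / 2 <= a ->
  laplace x a (b + INR n) = sum_n (fun k => Binomial.C n k * laplace x (a + INR k) b) n.
Proof.
  intros Hx Ha.
  assert (HK : forall k, dominated (ker x (a + INR k) b)).
  { intros k. apply dominated_ker; auto. pose proof (pos_INR k). lra. }
  destruct (dominated_sum_n (fun k t => Binomial.C n k * ker x (a + INR k) b t) n) as (_ & E).
  { intros k. now apply dominated_scal. }
  unfold laplace at 1.
  transitivity (half_int (fun t => sum_n (fun k => Binomial.C n k * ker x (a + INR k) b t) n)).
  - apply half_int_ext. intros t Ht.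
    transitivity ((1 + t) ^ n * ker x a b t).
    + rewrite <- Rpower_pow by lra. unfold Rpower, ker. rewrite <- exp_plus. f_equal. ring.
    + replace (1 + t) with (t + 1) by ring. rewrite binomial, Rmult_comm, <- sum_n_Reals.
      etransitivity; [symmetry; apply (sum_n_mult_l (K := R_Ring))|].
      apply sum_n_ext. intros k. rewrite <- ker_mul_pow by auto.
      unfold mult; simpl. as_R_eq. rewrite pow1. ring.
  - rewrite E. apply sum_n_ext. intros k. now apply half_int_scal.
Qed.

(** * The derivative of W at kappa = 0 *)

Lemma sum_n_linear (a b : R) (u v : nat -> R) (n : nat) :
  sum_n (fun k => a * u k + b * v k) n = a * sum_n u n + b * sum_n v n.
Proof.
  etransitivity; [apply (sum_n_plus (G := R_AbelianMonoid) (fun k => a * u k))|].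
  rewrite <- !(sum_n_mult_l (K := R_Ring)). reflexivity.
Qed.

Lemma is_derive_whittakerW (n : nat) (x : R) :
  0 < x ->
  is_derive (fun kappa => whittakerW kappa (INR n + 1 / 2) x) 0
    (exp (- x / 2) * sum_n (fun k =>
      INR (fact (n + k)) * powerRZ x (- Z.of_nat k) / (INR (fact k) * INR (fact (n - k)))
      * (harmonic n - harmonic (n + k) + ln x
         + x ^ (n + k + 1) / INR (fact (n + k)) * laplace_ln1p x (INR (n + k)) 0)) n).
Proof.
  intros Hx. pose proof (pos_INR n) as Hn.
  set (p := Rpower x (INR n + 1)).
  set (num := fun s : R =>
    (sum_n (fun k => Binomial.C n k * laplace x (INR (n + k) - s) (0 + s)) n : R)).
  set (den := fun s => laplace 1 (INR n - s) (0 + 0)).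
  assert (HN : is_derive num 0 (sum_n (fun k => Binomial.C n k
    * (laplace_ln1p x (INR (n + k)) 0 - laplace_ln x (INR (n + k)) 0)) n)).
  { apply (is_derive_sum_n
      (fun k s => Binomial.C n k * laplace x (INR (n + k) - s) (0 + s))).
    intros k _.
    apply (is_derive_scal (fun s => laplace x (INR (n + k) - s) (0 + s))).
    apply is_derive_laplace_ab; auto. pose proof (pos_INR (n + k)). lra. }
  assert (HD : is_derive den 0 (- laplace_ln 1 (INR n) 0)).
  { assert (H := is_derive_laplace_line 1 (INR n) 0 0 (-1) 0 Rlt_0_1 ltac:(lra)).
    replace (- laplace_ln 1 (INR n) 0) with (- 0 * laplace 1 (INR n + 1) 0
      + -1 * laplace_ln 1 (INR n) 0 + 0 * laplace_ln1p 1 (INR n) 0) by ring.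
    eapply is_derive_ext; [|exact H]. intros s. unfold den. simpl. f_equal; ring. }
  assert (D0 : den 0 = INR (fact n)).
  { unfold den. rewrite Rminus_0_r, Rplus_0_r, laplace_0, pow1 by lra. field. }
  pose proof (INR_fact_lt_0 n) as Hf.
  assert (HQ := is_derive_scal _ 0 (exp (- x / 2)) _ (is_derive_scal _ 0 p _
    (is_derive_div num den 0 _ _ HN HD ltac:(lra)))).
  apply (is_derive_ext_loc (fun s => exp (- x / 2) * (p * (num s / den s)))).
  (* The radius 1/2 keeps s below n + 1/2 and the exponents n - s above -1/2, even for n = 0. *)
  { assert (He : 0 < 1 / 2) by lra. exists (mkposreal _ He). intros s Hs.
    apply Rabs_def2 in Hs. unfold minus, plus, opp in Hs; simpl in Hs.
    rewrite whittakerW_laplace by lra.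
    replace (INR n + 1 / 2 + 1 / 2) with (INR n + 1) by field.
    replace (INR n + 1 / 2 - 1 / 2 - s) with (INR n - s) by field.
    replace (INR n + 1 / 2 - 1 / 2 + s) with (s + INR n) by field.
    rewrite laplace_binomial by lra. unfold p, num, den. rewrite Rplus_0_r.
    do 3 f_equal. apply sum_n_ext. intros k. rewrite plus_INR.
    do 2 f_equal; ring. }
  evar_last; [exact HQ|]. as_R_eq. clear HQ HN HD.
  f_equal. rewrite D0, laplace_ln_1_nat. unfold num.
  set (J := laplace_ln 1 0 0).
  (* U is the derivative of the numerator and V its value. Since the denominator has logarithmic
     derivative -(J + H_n), V enters with the factor J + H_n. *)
  match goal with |- p * ((?U * _ - ?V * _) / _) = _ =>
    transitivity (p / INR (fact n) * U + p * (J + harmonic n) / INR (fact n) * V);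
      [field; lra|]
  end.
  rewrite <- sum_n_linear. apply sum_n_ext_loc. intros k Hk.
  pose proof (pos_INR (n + k)) as Hnk.
  rewrite Rminus_0_r, Rplus_0_r.
  assert (HJ := laplace_ln_scaling x (INR (n + k)) Hx ltac:(lra)).
  rewrite laplace_ln_1_nat, laplace_0 in HJ by auto. rewrite laplace_0 by auto.
  fold J in HJ. unfold p. rewrite Rpower_plus, Rpower_1, Rpower_pow in * by auto.
  rewrite powerRZ_neg', <- pow_powerRZ. unfold Binomial.C.
  rewrite !pow_add, !pow_1 in *.
  pose proof (INR_fact_lt_0 (n + k)). pose proof (INR_fact_lt_0 k).
  pose proof (INR_fact_lt_0 (n - k)).
  assert (0 < x ^ n) by now apply pow_lt. assert (0 < x ^ k) by now apply pow_lt.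
  set (fm := INR (fact (n + k))) in *. set (y := x ^ n) in *. set (z := x ^ k) in *.
  (* The scaling identity solved for the integral with ln t: up to the factor (n+k)! / x^(n+k+1) it
     is J + H_(n+k) - ln x. Entering with a minus sign, it cancels the J of the denominator. *)
  assert (HJ1 : laplace_ln x (INR (n + k)) 0
    = fm * (J + harmonic (n + k)) / (y * z * x) - ln x * (fm / (y * z * x))).
  { rewrite <- HJ. field. repeat split; lra. }
  rewrite HJ1. as_R_eq. field. repeat split; lra.
Qed.

(** At half-integer order the power of 1 + t in the integral for U is n, so the binomial expansion
    ends in the integrals (n+k)! / x^(n+k+1). *)
Lemma besselK_half (n : nat) (x : R) :
  0 < x ->
  sqrt (x / PI) * besselK (INR n + 1 / 2) (x / 2) =
  exp (- x / 2) * sum_n (fun k =>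
      INR (fact (n + k)) * powerRZ x (- Z.of_nat k) / (INR (fact k) * INR (fact (n - k)))) n.
Proof.
  intros Hx. pose proof (pos_INR n) as Hn. pose proof PI_RGT_0 as HPI.
  assert (HT := laplace_tricomi (INR n + 1 / 2 + 1 / 2) (2 * (INR n + 1 / 2) + 1) ltac:(lra)).
  rewrite (besselK_eq _ _ _ _ (x / 2) HT) by lra.
  replace (2 * (x / 2)) with x by field.
  replace (INR n + 1 / 2 + 1 / 2 - 1) with (INR n) by field.
  replace (2 * (INR n + 1 / 2) + 1 - (INR n + 1 / 2 + 1 / 2) - 1) with (0 + INR n) by field.
  rewrite laplace_binomial, laplace_0, pow1 by lra.
  rewrite sqrt_div by lra.
  rewrite Rpower_plus. replace (1 / 2) with (/ 2) by field.
  rewrite Rpower_pow, Rpower_sqrt by auto.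
  replace (- (x / 2)) with (- x / 2) by field.
  pose proof (INR_fact_lt_0 n) as Hf.
  assert (Hs : sqrt x * sqrt x = x) by (apply sqrt_sqrt; lra).
  pose proof (sqrt_lt_R0 PI HPI).
  match goal with |- _ * (_ * (?U / _)) = _ =>
    (* One sqrt x comes from the prefactor, the other from x^(n + 1/2); the summand 0 * U gives the
       shape required by [sum_n_linear]. *)
    transitivity (exp (- x / 2) * (x ^ n * (sqrt x * sqrt x) / INR (fact n) * U + 0 * U));
      [field; lra|]
  end.
  rewrite Hs. f_equal. rewrite <- sum_n_linear. apply sum_n_ext_loc. intros k Hk.
  rewrite <- plus_INR, laplace_0 by auto.
  rewrite powerRZ_neg', <- pow_powerRZ. unfold Binomial.C.
  rewrite !pow_add, !pow_1 in *.
  pose proof (INR_fact_lt_0 k). pose proof (INR_fact_lt_0 (n - k)).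
  assert (0 < x ^ n) by now apply pow_lt. assert (0 < x ^ k) by now apply pow_lt.
  as_R_eq. field. repeat split; lra.
Qed.

Theorem theorem20 (n : nat) (x mu : R) (hx : 0 < x)
  (hmu : mu = INR n + 1 / 2 \/ mu = - (INR n + 1 / 2)) :
  is_derive (fun kappa : R => whittakerW kappa mu x) 0
    (sqrt (x / PI) * besselK (INR n + 1 / 2) (x / 2)
       * (harmonic n + expint_E1 x + ln x)
     + exp (- x / 2)
       * sum_n (fun k : nat =>
           INR (fact (n + k)) * powerRZ x (- Z.of_nat k)
             / (INR (fact k) * INR (fact (n - k)))
           * ((-1) ^ (n + k + 1)
                * gamma_upper (- Z.of_nat n - Z.of_nat k) x
                * gamma_lower (Z.of_nat n + Z.of_nat k + 1) (- x)
              - harmonic (n + k)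
              - sum_n_m (fun l : nat =>
                  Binomial.C (n + k) l * powerRZ (- x) (- Z.of_nat l)
                    * gamma_lower (Z.of_nat l) x) 1 (n + k))) n).
Proof.
  pose proof (pos_INR n) as Hn.
  apply (is_derive_ext_loc (fun kappa => whittakerW kappa (INR n + 1 / 2) x)).
  (* For the negative sign W agrees with its value at n + 1/2 for |kappa| < 1/2, which is enough for
     the derivative at 0. *)
  { destruct hmu as [->| ->]; [now apply filter_forall|].
    assert (He : 0 < 1 / 2) by lra. exists (mkposreal _ He). intros s Hs.
    apply Rabs_def2 in Hs. unfold minus, plus, opp in Hs; simpl in Hs.
    symmetry. apply whittakerW_opp; lra. }
  evar_last; [exact (is_derive_whittakerW n x hx)|]. as_R_eq.
  rewrite besselK_half by auto.
  (* The bracket c = H_n + E_1(x) + ln x is independent of k, so the Bessel sum U carrying it is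
     merged with the remaining sum and the two sides are compared term by term. *)
  match goal with |- _ = ?e * ?U * ?c + _ * ?V => transitivity (e * (c * U + 1 * V)); [|ring] end.
  f_equal. rewrite <- sum_n_linear. apply sum_n_ext. intros k.
  rewrite laplace_ln1p_gamma by auto. rewrite Nat2Z.inj_add.
  replace (- (Z.of_nat n + Z.of_nat k))%Z with (- Z.of_nat n - Z.of_nat k)%Z by lia.
  unfold gamma_sum. as_R_eq. ring.
Qed.
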